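(* Let $N\ge 2$, let $\Omega\subset\mathbb{R}^N$ be a smooth bounded domain, $1^*=\frac{N}{N-1}$ and $q\in(1,1^* )$. Given $n\in\mathbb{N}$, there is $\lambda_n>0$ such that for every $\lambda\ge\lambda_n$ the problem $$-\Delta_1 u=\lambda|u|^{q-2}u+|u|^{1^*-2}u\ \text{ in }\Omega,\qquad u=0\ \text{ on }\partial\Omega,$$ has at least $n$ nontrivial solutions.
   Context: $BV(\Omega)$ is the space of functions of bounded variation on $\Omega$, $\int_\Omega|Du|$ is the total variation of $Du$, boundary values are taken in the sense of traces, and $\mathcal{H}^{N-1}$ is the $(N-1)$-dimensional Hausdorff measure. A function $u\in BV(\Omega)$ is a solution of the problem if there is $z\in L^\infty(\Omega,\mathbb{R}^N)$ such that $|z|_\infty\le1$, $\operatorname{div}z\in L^N(\Omega)$ (distributional divergence), $-\int_\Omega u\,\operatorname{div}z\,dx=\int_\Omega|Du|+\int_{\partial\Omega}|u|\,d\mathcal{H}^{N-1}$, and $-\operatorname{div}z=\lambda|u|^{q-2}u+|u|^{1^*-2}u$ a.e. in $\Omega$. Nontrivial means $u\not=0$ in $BV(\Omega)$. *)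

(* Defs.v *)
From HB Require Import structures.
From mathcomp Require Import all_boot all_order all_algebra.
From mathcomp Require Import all_classical all_reals all_analysis.

Set Implicit Arguments.
Unset Strict Implicit.
Unset Printing Implicit Defensive.
Import Order.TTheory GRing.Theory Num.Theory.
Import numFieldNormedType.Exports.

Local Open Scope classical_set_scope.
Local Open Scope ring_scope.

(* R^N is 'rV[R]_N.  Its library norm is the sup norm, so the Euclidean norm
   [enorm] is used wherever the metric matters.  Its sigma-algebra is generated
   by the coordinates (as the library does for tuples), i.e. it is the Borel
   sigma-algebra. *)
Fact rV_display : measure_display.
Proof. exact: default_measure_display. Qed.

Section measurable_rV.
Context {R : realType} {n : nat}.

Let coors : 'I_n -> 'rV[R]_n -> R := fun i x => x 0 i.

Let rV_set0 : g_sigma_preimage coors set0.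
Proof. exact: sigma_algebra0. Qed.

Let rV_setC A : g_sigma_preimage coors A -> g_sigma_preimage coors (~` A).
Proof. exact: sigma_algebraC. Qed.

Let rV_bigcup (F : _^nat) : (forall i, g_sigma_preimage coors (F i)) ->
  g_sigma_preimage coors (\bigcup_i (F i)).
Proof. exact: sigma_algebra_bigcup. Qed.

HB.instance Definition _ :=
  @isMeasurable.Build rV_display 'rV[R]_n (g_sigma_preimage coors)
    rV_set0 rV_setC rV_bigcup.

Lemma measurable_coord (i : 'I_n) :
  measurable_fun [set: 'rV[R]_n] (fun x : 'rV[R]_n => x 0 i).
Proof.
move=> _ Y mY; rewrite setTI; apply: sub_sigma_algebra => /=.
rewrite -bigcup_seq/=; exists i => /=; first by rewrite mem_index_enum.
by exists Y => //; rewrite setTI.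
Qed.

Lemma measurable_fun_rVP d (T : measurableType d) (f : T -> 'rV[R]_n) :
  measurable_fun [set: T] f <->
  forall i, measurable_fun [set: T] (fun x => f x 0 i).
Proof.
split=> [mf i|mf].
  exact: (measurableT_comp (measurable_coord i) mf).
move=> _ A mA; rewrite setTI.
pose G := [set B : set 'rV[R]_n | measurable (f @^-1` B)].
suff GA : g_sigma_preimage coors `<=` G by exact: GA.
apply: smallest_sub.
  split.
  - by rewrite /G/= preimage_set0.
  - by move=> B GB; rewrite /G/= setTD preimage_setC; exact: measurableC.
  - move=> F GF; rewrite /G/= preimage_bigcup.
    by apply: bigcup_measurable => k _; exact: GF.
rewrite -bigcup_seq/= => B [i _ [Y mY <-]].
by rewrite /G/= setTI -[X in measurable X]setTI; exact: mf.
Qed.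

End measurable_rV.

Section lebesgue_measure_rV.
Context {R : realType}.

(* (t, y) in R x R^n |-> (t, y_1, ..., y_n) in R^(1+n) *)
Definition rV_cons n (p : measurableTypeR R * 'rV[R]_n) : 'rV[R]_n.+1 :=
  row_mx (p.1%:M : 'rV[R]_1) p.2.

Lemma measurable_rV_cons n : measurable_fun [set: _] (@rV_cons n).
Proof.
apply/measurable_fun_rVP => i.
have -> : (fun p => @rV_cons n p 0 i) =
    (fun p => if @fintype.split 1 n i is inr j then p.2 0 j else p.1).
  apply/funext => p; rewrite /rV_cons mxE; case: fintype.split => // j.
  by rewrite mxE ord1 eqxx mulr1n.
case: fintype.split => [_|j]; first exact: measurable_fst.
exact: (measurableT_comp (measurable_coord j) measurable_snd).
Qed.

Definition rV_uncons n (x : 'rV[R]_n.+1) : measurableTypeR R * 'rV[R]_n :=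
  (x 0 0, \row_j x 0 (lift 0 j)).

Lemma measurable_rV_uncons n : measurable_fun [set: _] (@rV_uncons n).
Proof.
apply/measurable_fun_pairP; split; first exact: measurable_coord.
apply/measurable_fun_rVP => j.
rewrite (_ : (fun _ => _) = (fun x : 'rV[R]_n.+1 => x 0 (lift 0 j))).
  exact: measurable_coord.
by apply/funext => x /=; rewrite mxE.
Qed.

Lemma rV_consK n : cancel (@rV_cons n) (@rV_uncons n).
Proof.
move=> [t y]; rewrite /rV_uncons /rV_cons; congr pair.
  have -> : (0 : 'I_n.+1) = lshift n (0 : 'I_1) by exact/val_inj.
  by rewrite (@row_mxEl _ 1 1 n) mxE eqxx mulr1n.
apply/rowP => j; rewrite mxE.
have -> : lift (0 : 'I_n.+1) j = rshift 1 j by exact/val_inj.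
by rewrite (@row_mxEr _ 1 1 n).
Qed.

Section pushforward_cons.
Variables (n : nat) (m : {sigma_finite_measure set 'rV[R]_n -> \bar R}).

Let mu : set 'rV[R]_n.+1 -> \bar R :=
  pushforward (lebesgue_measure \x m)%E (@rV_cons n).

Let mu0 : mu set0 = 0%E.
Proof. by rewrite /mu /pushforward preimage_set0 measure0. Qed.

Let mu_ge0 A : (0 <= mu A)%E.
Proof. by rewrite /mu /pushforward measure_ge0. Qed.

Let mu_sigma_additive : semi_sigma_additive mu.
Proof.
move=> F mF tF mUF; rewrite /mu /pushforward preimage_bigcup.
apply: measure_semi_sigma_additive.
- by move=> k; rewrite -[X in measurable X]setTI; exact: measurable_rV_cons.
- apply/trivIsetP => /= i j _ _ ij; rewrite -preimage_setI.
  by move/trivIsetP : tF => /(_ _ _ _ _ ij) ->//; rewrite preimage_set0.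
- rewrite -preimage_bigcup -[X in measurable X]setTI.
  exact: measurable_rV_cons.
Qed.

Let mu_sigma_finite : sigma_finite setT mu.
Proof.
have /sigma_finiteP[F [TF ndF Foo]] := sigma_finiteT (@lebesgue_measure R).
have /sigma_finiteP[G [TG ndG Goo]] := sigma_finiteT m.
exists (fun k => @rV_uncons n @^-1` (F k `*` G k)).
  rewrite -preimage_bigcup -(preimage_setT (@rV_uncons n)); congr (_ @^-1` _).
  rewrite -setXTT TF TG predeqE => -[x y]; split.
    move=> [/= [a _ Fax] [b _ Gby]]; exists (maxn a b) => //; split.
    - by move: x Fax; exact/subsetPset/ndF/leq_maxl.
    - by move: y Gby; exact/subsetPset/ndG/leq_maxr.
  by move=> [k _ [/= ? ?]]; split; exists k.
move=> k; have [mF ?] := Foo k; have [mG ?] := Goo k.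
have mFG : measurable (F k `*` G k) by exact: measurableX.
split; first by rewrite -[X in measurable X]setTI; exact: measurable_rV_uncons.
rewrite /mu /pushforward -comp_preimage.
rewrite (_ : _ \o _ = id); last by rewrite funeqE; exact: rV_consK.
by rewrite preimage_id product_measure1E// lte_mul_pinfty// ge0_fin_numE.
Qed.

HB.instance Definition _ := isMeasure.Build _ _ _ mu
  mu0 mu_ge0 mu_sigma_additive.

HB.instance Definition _ := Measure_isSigmaFinite.Build _ _ _ mu
  mu_sigma_finite.

Definition lebesgue_rV_succ :
  {sigma_finite_measure set 'rV[R]_n.+1 -> \bar R} :=
  mu.

End pushforward_cons.

(* Lebesgue measure on R^n: the n-fold product of the one on R *)
Fixpoint lebesgue_rV n : {sigma_finite_measure set 'rV[R]_n -> \bar R} :=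
  match n with
  | 0 => dirac (0 : 'rV[R]_0)
  | m.+1 => lebesgue_rV_succ (lebesgue_rV m)
  end.

End lebesgue_measure_rV.

Local Notation leb := (lebesgue_rV _).

Section euclidean.
Context {R : realType} {N : nat}.
Implicit Types (x y p : 'rV[R]_N) (A C : set 'rV[R]_N).

Definition dotv x y : R := \sum_(i < N) x 0 i * y 0 i.

Definition enorm x : R := Num.sqrt (dotv x x).

Definition eball p (r : R) : set 'rV[R]_N := [set x | enorm (x - p) < r].

Definition ediam C : \bar R :=
  ereal_sup [set (enorm (xy.1 - xy.2))%:E | xy in C `*` C].

Definition bd A : set 'rV[R]_N := closure A `\` A°.

End euclidean.

Section hausdorff.
Context {R : realType} {N : nat}.
Implicit Types A C : set 'rV[R]_N.

(* The volume of the unit ball of R^k normalises H^k to be the k-dimensional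
   area on smooth k-dimensional surfaces. *)
Definition hausdorff_gauge (k : nat) C : \bar R :=
  if C == set0 then 0%E
  else (leb (eball (0 : 'rV[R]_k) 1) * ((fine (ediam C) / 2) ^+ k)%:E)%E.

Definition hausdorff_pre (k : nat) (delta : R) A : \bar R :=
  ereal_inf [set (\sum_(i <oo) hausdorff_gauge k (C i))%E |
    C in [set C : (set 'rV[R]_N)^nat | A `<=` \bigcup_i C i /\
                                       forall i, (ediam (C i) <= delta%:E)%E]].

Definition hausdorff (k : nat) A : \bar R :=
  ereal_sup [set hausdorff_pre k delta A | delta in [set d : R | 0 < d]].

End hausdorff.

Section differentiability.
Context {R : realType} {N : nat}.
Implicit Types (f : 'rV[R]_N -> R) (phi : 'rV[R]_N -> 'rV[R]_N).

Definition basis_vec (i : 'I_N) : 'rV[R]_N := delta_mx 0 i.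

Definition partial (i : 'I_N) f : 'rV[R]_N -> R :=
  fun x => 'D_(basis_vec i) f x.

Definition iter_partial (s : seq 'I_N) f : 'rV[R]_N -> R := foldr partial f s.

Definition Ck (k : nat) f : Prop := forall s : seq 'I_N, (size s <= k)%N ->
  continuous (iter_partial s f) /\
  ((size s < k)%N ->
    forall i x, derivable (iter_partial s f) x (basis_vec i)).

Definition Cinfty f : Prop := forall k, Ck k f.

Definition grad f : 'rV[R]_N -> 'rV[R]_N := fun x => \row_i partial i f x.

Definition divergence phi : 'rV[R]_N -> R :=
  fun x => \sum_(i < N) partial i (fun y => phi y 0 i) x.

Definition compactly_supported_in (V : nmodType) (Omega : set 'rV[R]_N)
    (g : 'rV[R]_N -> V) : Prop :=
  exists K, [/\ compact K, K `<=` Omega & forall x, ~ K x -> g x = 0].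

Definition test_fun (Omega : set 'rV[R]_N) f : Prop :=
  Cinfty f /\ compactly_supported_in Omega f.

Definition C1c_field (Omega : set 'rV[R]_N) phi : Prop :=
  (forall i, Ck 1 (fun x => phi x 0 i)) /\ compactly_supported_in Omega phi.

End differentiability.

(* Near each boundary point, Omega is the region on one side of the graph of a
   smooth function of the other N - 1 coordinates. *)
Definition smooth_boundary (R : realType) (N : nat) (Omega : set 'rV[R]_N) :=
  forall p, bd Omega p ->
    exists (r : R) (i : 'I_N) (above : bool) (gamma : 'rV[R]_N.-1 -> R),
      [/\ 0 < r, Cinfty gamma & forall x, eball p r x ->
        (Omega x <-> if above then gamma (col' i x) < x 0 i
                     else x 0 i < gamma (col' i x))].

Definition smooth_bounded_domain (R : realType) (N : nat)
    (Omega : set 'rV[R]_N) : Prop :=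
  [/\ Omega !=set0, open Omega, connected Omega,
      exists M : R, forall x, Omega x -> enorm x <= M & smooth_boundary Omega].

Section problem.
Context {R : realType} {N : nat} (Omega : set 'rV[R]_N).
Implicit Types (u v d T : 'rV[R]_N -> R) (z : 'rV[R]_N -> 'rV[R]_N).

(* the total variation of Du on Omega, i.e. of u in the sense of BV *)
Definition bv_variation u : \bar R :=
  ereal_sup [set (\int[leb]_(x in Omega) (u x * divergence phi x)%:E)%E |
    phi in [set phi | C1c_field Omega phi /\ forall x, enorm (phi x) <= 1]].

Definition BV u : Prop :=
  leb.-integrable Omega (EFin \o u) /\ (bv_variation u < +oo)%E.

Definition ae_eq_in u v : Prop :=
  {ae leb, forall x, Omega x -> u x = v x}.

(* T is the trace of u: at H^(N-1)-almost every boundary point x,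
   T x is the limit in mean of u on Omega `&` B(x, r) as r -> 0. *)
Definition is_trace u T : Prop :=
  measurable_fun (bd Omega) T /\
  {ae (hausdorff N.-1 : set 'rV[R]_N -> \bar R), forall x, bd Omega x ->
    ((r ^- N)%:E * \int[leb]_(y in Omega `&` eball x r) (`|u y - T x|)%:E)%E
      @[r --> 0^'+] --> 0%E}.

Definition in_Linfty_ball z : Prop :=
  measurable_fun Omega z /\ {ae leb, forall x, Omega x -> enorm (z x) <= 1}.

Definition in_Lp (p : R) d : Prop :=
  measurable_fun Omega d /\
  (\int[leb]_(x in Omega) (`|d x| `^ p)%:E < +oo)%E.

(* d is the distributional divergence of z on Omega *)
Definition is_weak_div z d : Prop :=
  forall phi, test_fun Omega phi ->
    (\int[leb]_(x in Omega) (dotv (z x) (grad phi x))%:E =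
     - \int[leb]_(x in Omega) (d x * phi x)%:E)%E.

(* 1^* = N / (N - 1) *)
Definition crit_exp : R := N%:R / (N%:R - 1).

(* [`|t| `^ (a - 2) * t] is 0 at t = 0 for every a, as intended when a < 2. *)
Definition is_solution (lambda q : R) u : Prop :=
  BV u /\
  exists z d T,
    [/\ in_Linfty_ball z,
        in_Lp N%:R d /\ is_weak_div z d,
        is_trace u T,
        ((- \int[leb]_(x in Omega) (u x * d x)%:E) =
         bv_variation u
         + \int[hausdorff N.-1]_(x in bd Omega) (`|T x|)%:E)%E &
        ae_eq_in (fun x => - d x)
          (fun x => lambda * (`|u x| `^ (q - 2) * u x)
                    + `|u x| `^ (crit_exp - 2) * u x)].

End problem.

(* Main.v *)
Require Import Defs.
From mathcomp Require Import all_boot all_order all_algebra.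
From mathcomp Require Import all_classical all_reals all_analysis.
From mathcomp Require Import measurable_realfun.
From mathcomp Require Import ring lra.

(* The solutions are multiples of indicators of concentric balls.  For a closed
   ball B of center p and radius r in Omega, the field z equal to -(x - p) / r in
   B and to -r^(N-1) (x - p) / |x - p|^N outside B satisfies |z| <= 1 and
   -div z = (N / r) 1_B: balls are calibrable.  As Per(B) = (N / r) |B|, the
   function c 1_B, whose trace on the boundary of Omega is 0, is a solution as
   soon as lambda c^(q-1) + c^(1^*-1) = N / r, an equation in c > 0 which is
   solvable for every lambda > 0.  Different radii give different c.
   No surface measure is needed: both Per(B) = (N / r) |B| and the weak
   divergence of z follow from the divergence theorem for compactly supported C^1
   fields, applied to fields f(|x - p|^2) (x - p) where f converges to a
   discontinuous profile. *)

Set Implicit Arguments.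
Unset Strict Implicit.
Unset Printing Implicit Defensive.
Import Order.TTheory GRing.Theory Num.Theory.
Import numFieldNormedType.Exports.

Local Open Scope classical_set_scope.
Local Open Scope ring_scope.

(** Profiles are functions of s = |x - p|^2, a polynomial in x, so that fields f(s) (x - p) are C^1
    even at the center; their divergence is n f + 2 s f'. The obstacle is the limit under the
    integral: a cutoff that falls from 1 to 0 over a layer of given width has a derivative of order
    1 / width. It is overcome in two different ways. In the upper bound for the variation, the term
    with this derivative has a sign and is dropped. In the weak divergence of z, it is multiplied by
    1 / r - [kappa] s, which vanishes at s = r^2 because the two branches of z agree on the sphere;
    this factor is of the order of the width, so the divergences stay bounded and dominated
    convergence applies. The lower bound for the variation needs no passage to the limit under the
    integral: fields equal to (x - p) / rho on B, with rho > r, leave room for a cutoff inside the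
    ball of radius rho, and N / rho approaches N / r. *)

Section rV_measurability.
Context {R : realType}.

Lemma nbhs_rV_cube n (x : 'rV[R]_n) (U : set 'rV[R]_n) : nbhs x U ->
  exists2 e : R, 0 < e &
    forall y : 'rV[R]_n, (forall i, `|x 0 i - y 0 i| < e) -> U y.
Proof.
move=> /nbhs_ballP[e /= e0 eU]; exists e => // y xy; apply: eU.
by split => // i j; rewrite ord1; exact: xy.
Qed.

(** The sigma-algebra is generated by the coordinates, so an open set is written as the countable
    union of the cubes with rational center and radius 1 / (k + 1) that it contains. *)
Lemma open_rV_measurable n (U : set 'rV[R]_n) : open U -> measurable U.
Proof.
move=> oU.
pose cube (q : 'rV[rat]_n * nat) : set 'rV[R]_n :=
  [set y | forall i, `|y 0 i - ratr (q.1 0 i)| < q.2.+1%:R^-1].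
have -> : U = \bigcup_q (if `[< cube q `<=` U >] then cube q else set0).
  apply/seteqP; split => [x Ux|x [q _]]; last by case: asboolP => // + qx; apply.
  have [e e0 eU] := nbhs_rV_cube (open_nbhs_nbhs (conj oU Ux)).
  have [k ke] : exists k, k.+1%:R^-1 < e / 2 :> R.
    have [k _ /(_ k (leqnn k)) /= ?] :=
      near_infty_natSinv_lt (PosNum (divr_gt0 e0 (ltr0Sn R 1))).
    by exists k.
  have dq (i : 'I_n) : {q : rat | `|x 0 i - ratr q| < k.+1%:R^-1}.
    apply: cid.
    have [|q] := @rat_in_itvoo R (x 0 i - k.+1%:R^-1) (x 0 i + k.+1%:R^-1).
      by rewrite ltrBlDr -addrA ltrDl addr_gt0// invr_gt0.
    rewrite in_itv/= => /andP[q1 q2]; exists q.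
    by rewrite ltr_distlC q1 q2.
  exists (\row_i sval (dq i), k) => //; case: asboolP => [_|[]].
    by move=> i /=; rewrite mxE; exact: (svalP (dq i)).
  move=> y cy; apply: eU => i; rewrite -(subrK (ratr (sval (dq i))) (x 0 i)).
  rewrite -addrA (le_lt_trans (ler_normD _ _))// [e]splitr ltrD//.
    exact: lt_trans (svalP (dq i)) ke.
  by rewrite distrC; apply: lt_trans ke; have := cy i; rewrite /= mxE.
apply: countable_bigcupT_measurable => // q; case: ifP => // _.
have -> : cube q = \bigcap_(i in [set: 'I_n])
    ((fun y : 'rV[R]_n => y 0 i) @^-1`
     [set t | `|t - ratr (q.1 0 i)| < q.2.+1%:R^-1]).
  by apply/seteqP; split => y cy i => //; [move=> _; exact: cy|exact: (cy i)].
apply: fin_bigcap_measurable => // i _; rewrite -[X in measurable X]setTI.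
apply: (measurable_coord i) => //; apply: open_measurable.
rewrite (_ : mkset _ = ball (ratr (q.1 0 i) : R) q.2.+1%:R^-1).
  exact: ball_open.
by apply/seteqP; split => t /=; rewrite distrC.
Qed.

Lemma closed_rV_measurable n (F : set 'rV[R]_n) : closed F -> measurable F.
Proof.
move=> cF; rewrite -[F]setCK; apply: measurableC; apply: open_rV_measurable.
exact: closed_openC.
Qed.

Lemma continuous_rV_measurable n (f : 'rV[R]_n -> R) :
  continuous f -> measurable_fun setT f.
Proof.
move=> /continuousP cf.
apply: (measurability _ (RGenOpens.measurableE R)) => _ [_ [a [b ->]] <-].
rewrite setTI; apply: open_rV_measurable; apply: cf.
exact: itv_open.
Qed.

Lemma continuous_rVP (T : topologicalType) n (g : T -> 'rV[R]_n) :
  (forall i, continuous (fun t => g t 0 i)) -> continuous g.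
Proof.
move=> cg t A [P Pg PA]; rewrite nbhs_filterE.
have : \forall s \near t, forall i, P 0 i (g s 0 i).
  by apply: filter_forall => i; exact: (cg i t _ (Pg 0 i)).
by apply: filterS => s Ps; apply: PA => i j; rewrite ord1.
Qed.

Lemma rV_cons0 n (t : R) (y : 'rV[R]_n) : rV_cons (t, y) 0 0 = t.
Proof. exact: (congr1 fst (rV_consK (t, y))). Qed.

Lemma rV_consS n (t : R) (y : 'rV[R]_n) j : rV_cons (t, y) 0 (lift 0 j) = y 0 j.
Proof.
have /(congr1 (fun p : measurableTypeR R * 'rV[R]_n => p.2 0 j)) := rV_consK (t, y).
by rewrite mxE.
Qed.

Lemma continuous_rV_consl n (y : 'rV[R]_n) :
  continuous (fun t : R => rV_cons (t, y)).
Proof.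
apply: continuous_rVP => i; case: (unliftP 0 i) => [j|] -> t.
  rewrite (_ : (fun _ => _) = cst (y 0 j)); first exact: cvg_cst.
  by apply/funext => s; rewrite rV_consS.
rewrite (_ : (fun _ => _) = id); first exact: cvg_id.
by apply/funext => s; rewrite rV_cons0.
Qed.

Lemma continuous_rV_consr n (t : R) :
  continuous (fun y : 'rV[R]_n => rV_cons (t, y)).
Proof.
apply: continuous_rVP => i; case: (unliftP 0 i) => [j|] -> y.
  under eq_fun do rewrite rV_consS.
  exact: coord_continuous.
by under eq_fun do rewrite rV_cons0; exact: cst_continuous.
Qed.

Definition box n (a b : 'rV[R]_n) : set 'rV[R]_n :=
  [set x | forall i, a 0 i <= x 0 i <= b 0 i].

Lemma measurable_box n (a b : 'rV[R]_n) : measurable (box a b).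
Proof.
have -> : box a b = \bigcap_(i in [set: 'I_n])
    ((fun y : 'rV[R]_n => y 0 i) @^-1` `[a 0 i, b 0 i]%classic).
  apply/seteqP; split => y cy i; first by move=> _; rewrite /= in_itv/=; exact: cy.
  by have := cy i I; rewrite /= in_itv.
apply: fin_bigcap_measurable => // i _; rewrite -[X in measurable X]setTI.
exact: (measurable_coord i).
Qed.

(** Boxes serve as comparison sets: an outer one shows that the measure of a ball is finite, an
    inner one that it is positive. The induction peels off the first coordinate, as the definition
    of the measure does. *)
Lemma lebesgue_rV_box n (a b : 'rV[R]_n) : (forall i, a 0 i <= b 0 i) ->
  lebesgue_rV n (box a b) = (\prod_i (b 0 i - a 0 i))%:E.
Proof.
elim: n a b => [|n IH] a b ab.
  by rewrite big_ord0 /= diracE mem_set// => -[].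
rewrite big_ord_recl EFinM.
have -> : lebesgue_rV n.+1 (box a b) =
    (lebesgue_measure \x lebesgue_rV n)%E (@rV_cons R n @^-1` box a b) by [].
rewrite (_ : _ @^-1` _ = `[a 0 0, b 0 0]%classic `*`
   box (rV_uncons a).2 (rV_uncons b).2); last first.
  apply/seteqP; split => [[t y] /= h|[t y] /= [h1 h2] i].
    split; first by have := h 0; rewrite rV_cons0 in_itv.
    by move=> i; have := h (lift 0 i); rewrite rV_consS !mxE.
  case: (unliftP 0 i) => [j|] ->; last by rewrite rV_cons0; rewrite in_itv in h1.
  by rewrite rV_consS; have := h2 j; rewrite !mxE.
rewrite product_measure1E//; last exact: measurable_box.
rewrite IH => [|i]; last by rewrite !mxE.
congr (_ * _)%E; last by congr EFin; apply: eq_bigr => i _; rewrite !mxE.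
change (lebesgue_measure `[a 0 0, b 0 0]%classic = (b 0 0 - a 0 0)%:E).
rewrite lebesgue_measure_itv/= lte_fin; case: ifPn => //; rewrite -leNgt => ba.
by have /eqP -> : a 0 0 == b 0 0; [rewrite eq_le ab ba|rewrite subrr].
Qed.

Lemma lebesgue_rV_box_lty n (a b : 'rV[R]_n) :
  (lebesgue_rV n (box a b) < +oo)%E.
Proof.
have [[i abi]|/forallNP ab] := pselect (exists i, b 0 i < a 0 i).
  rewrite (_ : box a b = set0) ?measure0// -subset0 => x /(_ i) /andP[ax xb].
  by have := lt_le_trans abi (le_trans ax xb); rewrite ltxx.
rewrite lebesgue_rV_box ?ltry// => i.
by rewrite leNgt; apply/negP/ab.
Qed.

End rV_measurability.

(** * Integrals of partial derivatives of functions vanishing outside a cube *)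

Section integration_of_partial_derivatives.
Context {R : realType}.
Local Notation leb := (lebesgue_rV _).

(** Cubes stand for bounded regions throughout: they are compact, have finite measure, and split as
    products along the first coordinate, as Fubini requires. *)
Definition cube n (M : R) : set 'rV[R]_n := box (const_mx (- M)) (const_mx M).

Lemma cubeP n (M : R) (x : 'rV[R]_n) : cube M x <-> forall i, `|x 0 i| <= M.
Proof.
split=> cx i; have := cx i; first by rewrite !mxE ler_norml.
by rewrite /= !mxE ler_norml.
Qed.

Lemma bounded_integrable_cube n (M C : R) (F : 'rV[R]_n -> R) :
  measurable_fun setT F -> (forall x, `|F x| <= C) ->
  (forall x, ~ cube M x -> F x = 0) -> leb.-integrable setT (EFin \o F).
Proof.
move=> mF FC F0; have mB := measurable_box (const_mx (- M)) (const_mx M : 'rV[R]_n).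
have iF : leb.-integrable (cube M) (EFin \o F).
  apply: measurable_bounded_integrable => //; first exact: lebesgue_rV_box_lty.
    exact: measurable_funTS.
  by exists C; split; [exact: num_real|move=> x Cx y _; exact: le_trans (ltW Cx)].
have := (integrable_mkcond (EFin \o F) mB).1 iF; apply: eq_integrable => // x _.
rewrite patchE; case: ifPn => // /negP xM; rewrite /= F0// => Mx.
by apply: xM; rewrite inE.
Qed.

Lemma compact_cube n (M : R) : compact (cube M : set 'rV[R]_n).
Proof.
have := @rV_compact R n (fun=> `[-M, M]%classic) (fun=> @segment_compact _ _ _).
congr compact; apply/seteqP; split => x cx i; have := cx i;
  by rewrite /= in_itv/= !mxE.
Qed.

Lemma continuous_cube_bounded n (M : R) (F : 'rV[R]_n -> R) :
  continuous F -> (forall x, ~ cube M x -> F x = 0) ->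
  exists C, forall x, `|F x| <= C.
Proof.
move=> cF F0.
have /compact_bounded[C [_ FC]] : compact (F @` cube M).
  by apply: continuous_compact; [exact: continuous_subspaceT|exact: compact_cube].
exists (`|C| + 1) => x; have [Mx|/F0 ->] := pselect (cube M x).
  by apply: (FC (`|C| + 1)); [rewrite ltr_pwDr// ler_norm|exists x].
by rewrite normr0 addr_ge0.
Qed.

Lemma continuous_cube_integrable n (M : R) (F : 'rV[R]_n -> R) :
  continuous F -> (forall x, ~ cube M x -> F x = 0) ->
  leb.-integrable setT (EFin \o F).
Proof.
move=> cF F0; have [C FC] := continuous_cube_bounded cF F0.
exact: (bounded_integrable_cube (continuous_rV_measurable cF) FC F0).
Qed.

Lemma shift_rV_cons0 n (h t : R) (y : 'rV[R]_n) :
  h *: basis_vec 0 + rV_cons (t, y) = rV_cons (h *: (1 : R) + t, y).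
Proof.
apply/rowP => i; rewrite [LHS]mxE; case: (unliftP 0 i) => [j|] ->.
  by rewrite !rV_consS !mxE/= mulr0 add0r.
by rewrite !rV_cons0 !mxE.
Qed.

Lemma shift_rV_consS n (h t : R) (y : 'rV[R]_n) j :
  h *: basis_vec (lift 0 j) + rV_cons (t, y) = rV_cons (t, h *: basis_vec j + y).
Proof.
apply/rowP => i; rewrite [LHS]mxE; case: (unliftP 0 i) => [k|] ->.
  by rewrite !rV_consS !mxE (inj_eq lift_inj).
by rewrite !rV_cons0 !mxE /= mulr0 add0r.
Qed.

Lemma derivable_rV_cons0 n (f : 'rV[R]_n.+1 -> R) t y :
  derivable f (rV_cons (t, y)) (basis_vec 0) ->
  derivable (fun s => f (rV_cons (s, y))) t 1.
Proof.
rewrite /derivable; under eq_fun do rewrite /= shift_rV_cons0.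
by [].
Qed.

Lemma partial_rV_cons0 n (f : 'rV[R]_n.+1 -> R) t y :
  partial 0 f (rV_cons (t, y)) = 'D_1 (fun s => f (rV_cons (s, y))) t.
Proof.
by rewrite /partial /derive; under eq_fun do rewrite /= shift_rV_cons0.
Qed.

Lemma derivable_rV_consS n (f : 'rV[R]_n.+1 -> R) t y j :
  derivable f (rV_cons (t, y)) (basis_vec (lift 0 j)) ->
  derivable (fun z => f (rV_cons (t, z))) y (basis_vec j).
Proof.
rewrite /derivable; under eq_fun do rewrite /= shift_rV_consS.
by [].
Qed.

Lemma partial_rV_consS n (f : 'rV[R]_n.+1 -> R) t y j :
  partial (lift 0 j) f (rV_cons (t, y)) = partial j (fun z => f (rV_cons (t, z))) y.
Proof.
by rewrite /partial /derive; under eq_fun do rewrite /= shift_rV_consS.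
Qed.

Lemma cube_rV_cons n (M t : R) (y : 'rV[R]_n) :
  cube M (rV_cons (t, y)) <-> `|t| <= M /\ cube M y.
Proof.
rewrite !cubeP; split=> [cM|[tM yM] i].
  by split=> [|i]; [have := cM 0; rewrite rV_cons0|
                    have := cM (lift 0 i); rewrite rV_consS].
by case: (unliftP 0 i) => [k|] ->; rewrite ?rV_consS ?rV_cons0.
Qed.

Lemma derive_off_cube n (M : R) (F : 'rV[R]_n -> R) v x :
  (forall x, ~ cube M x -> F x = 0) -> ~ cube M x -> 'D_v F x = 0.
Proof.
move=> F0 xM; rewrite -(derive_cst 0 x v); apply: near_eq_derive.
have : open (~` cube M : set 'rV[R]_n).
  by apply: closed_openC; apply: compact_closed;
    [exact: norm_hausdorff|exact: compact_cube].
rewrite openE => /(_ _ xM); apply: filterS => z; exact: F0.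
Qed.

Lemma integral_derive_cube1 (M : R) (g : R -> R) :
  (forall t, derivable g t 1) -> continuous (fun t => 'D_1 g t) ->
  (forall t, M < `|t| -> g t = 0) ->
  (\int[lebesgue_measure]_t ('D_1 g t)%:E = 0)%E.
Proof.
move=> dg cg g0.
(* [a] exceeds [M] strictly, hence [g] vanishes at both ends of [I]; it is positive whatever the
   sign of [M]. *)
pose a : R := `|M| + 1.
pose I := `[- a, a]%classic.
have a0 : 0 < a by rewrite /a ltr_wpDl.
have Ma : M < a by rewrite (le_lt_trans (ler_norm M))// ltrDl.
have cg' : continuous g.
  by move=> t; apply/differentiable_continuous/derivable1_diffP.
transitivity (\int[lebesgue_measure]_(t in I) ('D_1 g t)%:E)%E.
  rewrite [RHS]integral_mkcond; apply: eq_integral => t _.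
  rewrite patchE; case: ifPn => // /negP; rewrite inE/= /I/= in_itv/= -ler_norml => ta.
  congr EFin; rewrite -(derive_cst 0 t 1); apply: near_eq_derive.
  have : a < `|t| by rewrite ltNge; apply/negP.
  move=> {}ta; have : (fun s : R => `|s|) @ t --> `|t| by exact: norm_continuous.
  move=> /cvgrPdist_lt/(_ (`|t| - a)); rewrite subr_gt0 => /(_ ta).
  apply: filterS => s /=; rewrite ltr_distlC => /andP[+ _].
  by rewrite opprB addrC subrK => as_; apply: g0; apply: lt_trans as_.
have ga : g a = 0 by apply: g0; rewrite gtr0_norm.
have gNa : g (- a) = 0 by apply: g0; rewrite normrN gtr0_norm.
rewrite (@continuous_FTC2 _ (fun t => 'D_1 g t) g).
- by rewrite ga gNa subee.
- by rewrite gt0_cp.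
- exact: continuous_subspaceT.
- split=> [t _ //||]; first by apply: cvg_at_right_filter; exact: cg'.
  by apply: cvg_at_left_filter; exact: cg'.
- by move=> t _; rewrite derive1E.
Qed.

(** By Fubini, with the order of integration chosen so that the inner integral is already 0: for the
    first coordinate it is the one-dimensional case, for another one it is the induction hypothesis
    on the slice at fixed [t]. *)
Lemma integral_partial_cube n (i : 'I_n) (M : R) (f : 'rV[R]_n -> R) :
  (forall x, derivable f x (basis_vec i)) -> continuous (partial i f) ->
  (forall x, ~ cube M x -> f x = 0) ->
  (\int[leb]_x (partial i f x)%:E = 0)%E.
Proof.
elim: n i f => [[]//|n IH] i f df cf f0.
have F0 x : ~ cube M x -> partial i f x = 0 by exact: derive_off_cube.
have iF := continuous_cube_integrable cf F0.
have mF : measurable_fun setT (EFin \o partial i f).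
  by apply/measurable_EFinP; exact: continuous_rV_measurable.
have mFc : measurable_fun setT ((EFin \o partial i f) \o @rV_cons R n).
  by apply: measurableT_comp => //; exact: measurable_rV_cons.
have iFc : (lebesgue_measure \x lebesgue_rV n)%E.-integrable setT
    ((EFin \o partial i f) \o @rV_cons R n).
  apply/integrableP; split => //; move/integrableP : iF => [_].
  (* The measure on R^(n+1) is by definition this pushforward, so the two sides are convertible. *)
  rewrite (_ : \int[leb]_x _ =
    \int[pushforward (lebesgue_measure \x lebesgue_rV n)%E (@rV_cons R n)]_x
      `|(EFin \o partial i f) x|)%E//.
  rewrite ge0_integral_pushforward//; first exact: measurable_rV_cons.
  exact: measurableT_comp.
transitivity (\int[(lebesgue_measure \x lebesgue_rV n)%E]_p
    ((EFin \o partial i f) \o @rV_cons R n) p)%E.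
  exact: (integral_pushforward (@measurable_rV_cons R n) mF iFc measurableT).
case: (unliftP 0 i) => [j ij|i0].
  rewrite -integral12_prod_meas1//; apply: integral0_eq => t _.
  rewrite /fubini_F /= ij; under eq_integral do rewrite /= partial_rV_consS.
  apply: IH => [y||y yM].
  - by apply: derivable_rV_consS; rewrite -ij.
  - rewrite (_ : partial _ _ = partial i f \o (fun y => rV_cons (t, y))); last first.
      by apply/funext => y /=; rewrite ij partial_rV_consS.
    by move=> y; apply: continuous_comp; [exact: continuous_rV_consr|exact: cf].
  - by apply: f0; rewrite cube_rV_cons => -[].
rewrite -integral21_prod_meas1//; apply: integral0_eq => y _.
rewrite /fubini_G /= i0; under eq_integral do rewrite /= partial_rV_cons0.
apply: (@integral_derive_cube1 M) => [t||t tM].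
- by apply: derivable_rV_cons0; rewrite -i0.
- rewrite (_ : (fun _ => _) = partial i f \o (fun t => rV_cons (t, y))); last first.
    by apply/funext => t /=; rewrite i0 partial_rV_cons0.
  by move=> t; apply: continuous_comp; [exact: continuous_rV_consl|exact: cf].
- by apply: f0; rewrite cube_rV_cons => -[]; rewrite leNgt tM.
Qed.

End integration_of_partial_derivatives.

(** * Rules of calculus for C^1 functions, and the divergence theorem *)

Section C1_functions.
Context {R : realType} {n : nat}.
Implicit Types (f g : 'rV[R]_n -> R) (x : 'rV[R]_n).
Local Notation leb := (lebesgue_rV _).

Lemma is_derive_mul f g x v df dg : is_derive x v f df -> is_derive x v g dg ->
  is_derive x v (fun y => f y * g y) (f x * dg + g x * df).
Proof. exact: is_deriveM. Qed.

Lemma is_derive_add f g x v df dg : is_derive x v f df -> is_derive x v g dg ->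
  is_derive x v (fun y => f y + g y) (df + dg).
Proof. exact: is_deriveD. Qed.

(** Only the derivative of [f] along [v] is given, so everything is restricted to the line t v + x,
    where the chain rule in one variable applies. *)
Lemma is_derive_chain f (h : R -> R) x v df dh :
  is_derive x v f df -> is_derive (f x) (1 : R) h dh ->
  is_derive x v (fun y => h (f y)) (dh * df).
Proof.
pose f1 t := f (t *: v + x).
have f1E : f1 0 = f x by rewrite /f1 scale0r add0r.
have lineE (k : 'rV[R]_n -> R) : 'D_v k x = 'D_1 (fun t : R => k (t *: v + x)) 0.
  rewrite /derive; set g1 := fun t => _; set g2 := fun t => _.
  suff -> : g1 = g2 by [].
  by apply/funext => t; rewrite /g1 /g2 /= addr0 scale0r add0r [_%:A]mulr1.
move=> [df1 dfE] dhE; have d1 : is_derive (0 : R) 1 f1 df.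
  apply: DeriveDef; last by rewrite -dfE lineE.
  exact: ((derivable1P f x v).1 df1).
have [dc dcE] : is_derive (0 : R) 1 (h \o f1) (dh * df).
  by apply: is_derive1_comp; rewrite f1E.
apply: DeriveDef; last by rewrite lineE.
exact: ((derivable1P (fun y => h (f y)) x v).2 dc).
Qed.

Lemma is_derive_coord x (i j : 'I_n) :
  is_derive x (basis_vec i) (fun y : 'rV[R]_n => y 0 j) ((i == j)%:R).
Proof.
have dx : differentiable (fun y : 'rV[R]_n => y 0 j) x.
  exact: differentiable_coord.
apply: DeriveDef; first exact: diff_derivable.
rewrite /derive; apply: cvg_lim => //=.
apply: (@cvg_trans _ ((fun=> (i == j)%:R) @ (0 : R)^')); last exact: cvg_cst.
apply: near_eq_cvg; near=> h; have h0 : h != 0 by near: h; exact: nbhs_dnbhs_neq.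
by rewrite /= !mxE addrK eqxx/= [j == i]eq_sym [_ *: _]mulrA mulVf// mul1r.
Unshelve. all: by end_near. Qed.

Lemma Ck1P f : Ck 1 f <-> continuous f /\
  forall i, (forall x, derivable f x (basis_vec i)) /\ continuous (partial i f).
Proof.
split=> [Cf|[cf df] [|i [|//]] //= _]; last 2 first.
- by split=> // _ i x; exact: (df i).1.
- by split=> //; exact: (df i).2.
split; first exact: (Cf [::] isT).1.
move=> i; split; last exact: (Cf [:: i] isT).1.
by move=> x; exact: ((Cf [::] isT).2 isT i x).
Qed.

Lemma Ck1_derive f (df : 'I_n -> 'rV[R]_n -> R) :
  continuous f -> (forall i x, is_derive x (basis_vec i) f (df i x)) ->
  (forall i, continuous (df i)) -> Ck 1 f /\ forall i, partial i f = df i.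
Proof.
move=> cf dfE cdf; have pE i : partial i f = df i.
  by apply/funext => x; rewrite /partial; apply: derive_val.
by split=> //; apply/Ck1P; split=> // i; rewrite pE.
Qed.

Lemma Ck1_is_derive f i x : Ck 1 f -> is_derive x (basis_vec i) f (partial i f x).
Proof. by move=> /Ck1P[_ /(_ i)[df _]]; exact: derivableP. Qed.

Lemma Ck1_continuous f : Ck 1 f -> continuous f.
Proof. by move=> /Ck1P[]. Qed.

Lemma Ck1_continuous_partial f i : Ck 1 f -> continuous (partial i f).
Proof. by move=> /Ck1P[_ /(_ i)[]]. Qed.

Lemma continuous_mul f g : continuous f -> continuous g ->
  continuous (fun x => f x * g x).
Proof. by move=> cf cg x; exact: (cvgM (cf x) (cg x)). Qed.

Lemma continuous_add f g : continuous f -> continuous g ->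
  continuous (fun x => f x + g x).
Proof. by move=> cf cg x; exact: (cvgD (cf x) (cg x)). Qed.

Lemma continuous_sum_ord m (f : 'I_m -> 'rV[R]_n -> R) :
  (forall i, continuous (f i)) -> continuous (fun x => \sum_i f i x).
Proof. by move=> cf; apply: continuous_big => //; exact: add_continuous. Qed.

Lemma continuous_compR f (h : R -> R) : continuous f -> continuous h ->
  continuous (fun x => h (f x)).
Proof. by move=> cf ch x; exact: (continuous_comp (cf x) (ch (f x))). Qed.

Lemma Ck1M f g : Ck 1 f -> Ck 1 g -> Ck 1 (fun x => f x * g x) /\
  forall i, partial i (fun x => f x * g x) =
    fun x => f x * partial i g x + g x * partial i f x.
Proof.
move=> Cf Cg; apply: Ck1_derive => [|i x|i].
- by apply: continuous_mul; exact: Ck1_continuous.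
- by apply: is_derive_mul; exact: Ck1_is_derive.
- by apply: continuous_add; apply: continuous_mul; first
    [exact: Ck1_continuous|exact: Ck1_continuous_partial].
Qed.

Lemma Ck1D f g : Ck 1 f -> Ck 1 g -> Ck 1 (fun x => f x + g x) /\
  forall i, partial i (fun x => f x + g x) = fun x => partial i f x + partial i g x.
Proof.
move=> Cf Cg; apply: Ck1_derive => [|i x|i].
- by apply: continuous_add; exact: Ck1_continuous.
- by apply: is_derive_add; exact: Ck1_is_derive.
- by apply: continuous_add; exact: Ck1_continuous_partial.
Qed.

Lemma Ck1_cst (c : R) : Ck 1 (fun _ : 'rV[R]_n => c) /\
  forall i, partial i (fun _ : 'rV[R]_n => c) = fun=> 0.
Proof.
by apply: Ck1_derive => [|i]; exact: cst_continuous.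
Qed.

Lemma Ck1_coord j : Ck 1 (fun x : 'rV[R]_n => x 0 j) /\
  forall i, partial i (fun x : 'rV[R]_n => x 0 j) = fun=> (i == j)%:R.
Proof.
apply: Ck1_derive => [|i x|i]; [exact: coord_continuous| |exact: cst_continuous].
exact: is_derive_coord.
Qed.

Lemma Ck1_sum m (f : 'I_m -> 'rV[R]_n -> R) : (forall j, Ck 1 (f j)) ->
  Ck 1 (fun x => \sum_j f j x) /\
  forall i, partial i (fun x => \sum_j f j x) = fun x => \sum_j partial i (f j) x.
Proof.
move=> Cf; apply: Ck1_derive => [|i x|i].
- by apply: continuous_sum_ord => j; exact: Ck1_continuous.
- have -> : (fun y => \sum_j f j y) = \sum_j f j by apply/funext => y; rewrite fct_sumE.
  by apply: is_derive_sum => j; exact: Ck1_is_derive.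
- by apply: continuous_sum_ord => j; exact: Ck1_continuous_partial.
Qed.

Lemma Ck1_chain f (h dh : R -> R) : Ck 1 f ->
  (forall t, is_derive t (1 : R) h (dh t)) -> continuous dh ->
  Ck 1 (fun x => h (f x)) /\
  forall i, partial i (fun x => h (f x)) = fun x => dh (f x) * partial i f x.
Proof.
move=> Cf hE cdh; apply: Ck1_derive => [|i x|i].
- apply: continuous_compR; first exact: Ck1_continuous.
  by move=> t; apply/differentiable_continuous/derivable1_diffP; case: (hE t).
- by apply: is_derive_chain; exact: Ck1_is_derive.
- apply: continuous_mul; last exact: Ck1_continuous_partial.
  by apply: continuous_compR => //; exact: Ck1_continuous.
Qed.

Lemma integral_divergence_cube (M : R) (Phi : 'rV[R]_n -> 'rV[R]_n) :
  (forall i, Ck 1 (fun x => Phi x 0 i)) -> (forall x, ~ cube M x -> Phi x = 0) ->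
  leb.-integrable setT (EFin \o divergence Phi) /\
  (\int[leb]_x (divergence Phi x)%:E = 0)%E.
Proof.
move=> CP P0.
pose P i := partial i (fun x => Phi x 0 i).
have iP i : leb.-integrable setT (EFin \o P i).
  apply: (@continuous_cube_integrable _ _ M); first exact: Ck1_continuous_partial.
  by move=> x; apply: derive_off_cube => y /P0 ->; rewrite mxE.
have -> : EFin \o divergence Phi =
    fun x => (\sum_(i < n) (EFin \o P i) x)%E.
  by apply/funext => x; rewrite /= /divergence -sumEFin.
split; first exact: integrable_sum.
transitivity (\int[leb]_x (\sum_(i < n) (EFin \o P i) x))%E.
  by apply: eq_integral => x _; rewrite /divergence -sumEFin.
rewrite integral_sum// big1// => i _; apply: (@integral_partial_cube _ _ _ M).
- by move=> x; case/Ck1P: (CP i) => _ /(_ i)[].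
- exact: Ck1_continuous_partial.
- by move=> x /P0 ->; rewrite mxE.
Qed.

End C1_functions.

(** * A C^1 cutoff on the line, with a bound on its derivative *)

Section cutoff.
Context {R : realType}.

Definition pos2 (y : R) : R := Num.max y 0 ^+ 2.

Lemma is_derive_pos2 (y : R) : is_derive y (1 : R) pos2 (2 * Num.max y 0).
Proof.
have [y0|y0|->] := ltgtP y 0.
- rewrite mulr0; apply: (@near_eq_is_derive _ _ _ (cst 0)).
    near=> z; rewrite /pos2 max_r ?expr0n//= ltW//; near: z.
    exact: lt_nbhsl.
- have dsq : is_derive y (1 : R) (fun z : R => z * z) (2 * y).
    apply: is_derive_eq (is_deriveM (is_derive_id y (1 : R)) (is_derive_id y (1 : R))) _.
    by rewrite [_ *: _]mulr1 mulr2n mulrDl mul1r.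
  apply: near_eq_is_derive dsq.
  near=> z; rewrite /pos2 max_l ?expr2//= ltW//; near: z.
  exact: lt_nbhsr.
- rewrite ?maxxx mulr0.
  (* At 0 the difference quotient is at most |h| in absolute value. *)
  have cv : (fun h : R => h^-1 *: (pos2 (h *: 1 + 0) - pos2 0)) @ 0^' --> (0 : R).
    apply/cvgrPdist_lt => e e0; near=> h.
    have h0 : h != 0 by near: h; exact: nbhs_dnbhs_neq.
    rewrite sub0r normrN addr0 [h *: 1]mulr1 /pos2 maxxx expr0n subr0.
    rewrite [_ *: _]mulrC normrM normrX normfV expr2 -mulrA.
    have he : `|h| < e by near: h; exact: dnbhs0_lt.
    apply: le_lt_trans he; have [h1|h1] := leP h 0; first by rewrite normr0 mul0r.
    by rewrite mulfV ?mulr1// normr_eq0.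
  by apply: DeriveDef; [apply/cvg_ex; exists 0; exact: cv|exact: cvg_lim cv].
Unshelve. all: by end_near. Qed.

Lemma continuous_max0 : continuous (fun y : R => Num.max y 0).
Proof. by move=> y; apply: continuous_max; [exact: cvg_id|exact: cvg_cst]. Qed.

(* Squaring the positive parts makes this function C^1 in s. *)
Definition cutoff (a delta s : R) : R := pos2 (1 - pos2 ((s - a) / delta)).

Definition dcutoff (a delta s : R) : R :=
  - (4 / delta) * (Num.max (1 - pos2 ((s - a) / delta)) 0 * Num.max ((s - a) / delta) 0).

Variables (a delta : R).
Hypothesis delta0 : 0 < delta.

Lemma is_derive_cutoff (s : R) : is_derive s (1 : R) (cutoff a delta) (dcutoff a delta s).
Proof.
have d1 : is_derive s (1 : R) (fun s => (s - a) / delta) (delta^-1).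
  have := is_deriveM (is_deriveB (is_derive_id s (1 : R)) (is_derive_cst a s (1 : R)))
    (is_derive_cst delta^-1 s (1 : R)).
  by rewrite scaler0 add0r subr0 [_ *: _]mulr1.
have d2 : is_derive s (1 : R) (fun s => pos2 ((s - a) / delta)) _ :=
  @is_derive1_comp _ pos2 _ s _ _ (is_derive_pos2 ((s - a) / delta)) d1.
have d3 : is_derive s (1 : R) (fun s => 1 - pos2 ((s - a) / delta)) _ :=
  is_deriveB (is_derive_cst (1 : R) s (1 : R)) d2.
have d4 := @is_derive1_comp _ pos2 _ s _ _
  (is_derive_pos2 (1 - pos2 ((s - a) / delta))) d3.
apply: is_derive_eq d4 _; rewrite /dcutoff; ring.
Qed.

Lemma continuous_dcutoff : continuous (dcutoff a delta).
Proof.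
have c1 : continuous (fun s : R => (s - a) / delta).
  by move=> s; apply: cvgMl; apply: cvgB; [exact: cvg_id|exact: cvg_cst].
have c2 : continuous (fun s : R => 1 - pos2 ((s - a) / delta)).
  move=> s; apply: cvgB; first exact: cvg_cst.
  have [d _] := is_derive_pos2 ((s - a) / delta).
  have /differentiable_continuous c := (derivable1_diffP _ _).1 d.
  exact: (continuous_comp (c1 s) c).
move=> s.
have m1 : {for s,
    continuous (fun s : R => Num.max (1 - pos2 ((s - a) / delta)) 0)}.
  exact: (@continuous_comp _ _ _ _ (fun y : R => Num.max y 0) _
    (c2 s) (@continuous_max0 _)).
have m2 : {for s, continuous (fun s : R => Num.max ((s - a) / delta) 0)}.
  exact: (@continuous_comp _ _ _ _ (fun y : R => Num.max y 0) _
    (c1 s) (@continuous_max0 _)).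
exact: cvgM (cvg_cst _) (cvgM m1 m2).
Qed.

Lemma cutoff_le s : s <= a -> cutoff a delta s = 1.
Proof.
move=> sa; rewrite /cutoff /pos2 (max_r (x := _ / _)); last first.
  by rewrite pmulr_lle0 ?invr_gt0// subr_le0.
by rewrite expr0n subr0 max_l// expr1n.
Qed.

Lemma cutoff_ge s : a + delta <= s -> cutoff a delta s = 0.
Proof.
move=> sa; rewrite /cutoff /pos2; have s1 : 1 <= (s - a) / delta.
  by rewrite ler_pdivlMr// mul1r lerBrDl.
rewrite (max_l (x := _ / _)); last exact: le_trans s1.
by rewrite max_r ?expr0n// subr_le0 expr_ge1// (le_trans _ s1).
Qed.

Lemma cutoff_ge0 s : 0 <= cutoff a delta s.
Proof. exact: sqr_ge0. Qed.

Lemma cutoff_le1 s : cutoff a delta s <= 1.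
Proof.
rewrite /cutoff /pos2 exprn_ile1//; first by rewrite le_max lexx orbT.
by rewrite ge_max ler01 andbT gerBl sqr_ge0.
Qed.

Lemma dcutoff_le s : s <= a -> dcutoff a delta s = 0.
Proof.
move=> sa; rewrite /dcutoff (max_r (x := _ / _)) ?mulr0//.
by rewrite pmulr_lle0 ?invr_gt0// subr_le0.
Qed.

Lemma dcutoff_ge s : a + delta <= s -> dcutoff a delta s = 0.
Proof.
move=> sa; rewrite /dcutoff; have s1 : 1 <= (s - a) / delta.
  by rewrite ler_pdivlMr// mul1r lerBrDl.
rewrite (max_r (x := 1 - _)) ?mul0r ?mulr0// /pos2.
rewrite (max_l (x := _ / _)); last exact: le_trans s1.
by rewrite subr_le0 expr_ge1// (le_trans _ s1).
Qed.

Lemma dcutoff_le0 s : dcutoff a delta s <= 0.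
Proof.
have d0 : 0 <= 4 / delta by rewrite divr_ge0// ltW.
have m0 (t : R) : 0 <= Num.max t 0 by rewrite le_max lexx orbT.
by rewrite /dcutoff mulNr oppr_le0 (mulr_ge0 d0)// mulr_ge0.
Qed.

(** On the transition layer both positive parts are at most 1, which leaves the constant factor.
    This growth in 1 / delta is what [dprof_div_bounded] has to compensate. *)
Lemma normr_dcutoff s : `|dcutoff a delta s| <= 4 / delta.
Proof.
have d0 : 0 <= 4 / delta by rewrite divr_ge0// ltW.
have [sa|sa] := leP s (a + delta); last by rewrite dcutoff_ge ?normr0// ltW.
rewrite ler0_norm ?dcutoff_le0// /dcutoff mulNr opprK ler_piMr//.
have m0 (t : R) : 0 <= Num.max t 0 by rewrite le_max lexx orbT.
by rewrite mulr_ile1// ge_max ler01 andbT ?gerBl ?sqr_ge0// ler_pdivrMr// mul1r lerBlDl.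
Qed.

End cutoff.

(** * Divergence of products, the squared distance to p, Euclidean inequalities *)

Section divergence_rules.
Context {R : realType} {n : nat}.
Implicit Types (f g : 'rV[R]_n -> R) (x : 'rV[R]_n).
Implicit Types (Phi Psi : 'rV[R]_n -> 'rV[R]_n).

Definition C1_field Phi : Prop := forall i, Ck 1 (fun x => Phi x 0 i).

Lemma C1_field_scale f Psi : Ck 1 f -> C1_field Psi ->
  C1_field (fun x => f x *: Psi x).
Proof.
move=> Cf CPsi i; rewrite (_ : (fun _ => _) = fun x => f x * Psi x 0 i).
  exact: (Ck1M Cf (CPsi i)).1.
by apply/funext => x; rewrite mxE.
Qed.

Lemma C1_field_add Phi Psi : C1_field Phi -> C1_field Psi ->
  C1_field (fun x => Phi x + Psi x).
Proof.
move=> CPhi CPsi i; rewrite (_ : (fun _ => _) = fun x => Phi x 0 i + Psi x 0 i).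
  exact: (Ck1D (CPhi i) (CPsi i)).1.
by apply/funext => x; rewrite mxE.
Qed.

Lemma divergence_scale f Psi x : Ck 1 f -> C1_field Psi ->
  divergence (fun x => f x *: Psi x) x =
  f x * divergence Psi x + dotv (grad f x) (Psi x).
Proof.
move=> Cf CPsi; rewrite /divergence /dotv mulr_sumr -big_split/=.
apply: eq_bigr => i _; rewrite (_ : (fun _ => _) = fun x => f x * Psi x 0 i).
  by rewrite (Ck1M Cf (CPsi i)).2 [grad f x 0 i]mxE [partial i f x * _]mulrC.
by apply/funext => y; rewrite mxE.
Qed.

Lemma divergence_add Phi Psi x : C1_field Phi -> C1_field Psi ->
  divergence (fun x => Phi x + Psi x) x = divergence Phi x + divergence Psi x.
Proof.
move=> CPhi CPsi; rewrite /divergence -big_split/=; apply: eq_bigr => i _.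
rewrite (_ : (fun _ => _) = fun x => Phi x 0 i + Psi x 0 i).
  by rewrite (Ck1D (CPhi i) (CPsi i)).2.
by apply/funext => y; rewrite mxE.
Qed.

Lemma continuous_divergence Phi : C1_field Phi -> continuous (divergence Phi).
Proof.
by move=> CPhi; apply: continuous_sum_ord => i; exact: Ck1_continuous_partial.
Qed.

Variable p : 'rV[R]_n.

Lemma Ck1_disp i : Ck 1 (fun x => (x - p) 0 i) /\
  forall j, partial j (fun x => (x - p) 0 i) = fun=> (j == i)%:R.
Proof.
rewrite (_ : (fun _ => _) = fun x => x 0 i + (- p 0 i)); last first.
  by apply/funext => x; rewrite !mxE.
have [C1 E1] := @Ck1_coord R n i; have [C2 E2] := @Ck1_cst R n (- p 0 i).
have [C3 E3] := Ck1D C1 C2; split=> // j; rewrite E3 E1 E2.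
by apply/funext => x; rewrite addr0.
Qed.

Lemma C1_disp : C1_field (fun x => x - p).
Proof. by move=> i; exact: (Ck1_disp i).1. Qed.

Lemma divergence_disp x : divergence (fun x => x - p) x = n%:R.
Proof.
rewrite /divergence (eq_bigr (fun=> 1)) => [|i _]; last first.
  by rewrite (Ck1_disp i).2 eqxx.
by rewrite sumr_const card_ord.
Qed.

Definition sqd x : R := dotv (x - p) (x - p).

Lemma sqd_ge0 x : 0 <= sqd x.
Proof. by apply: sumr_ge0 => i _; rewrite -expr2 sqr_ge0. Qed.

Lemma enorm_sqd x : enorm (x - p) ^+ 2 = sqd x.
Proof. by rewrite sqr_sqrtr// sqd_ge0. Qed.

Lemma enorm_ge0 x : 0 <= enorm x. Proof. exact: sqrtr_ge0. Qed.

Lemma Ck1_sqd : Ck 1 sqd /\ forall i, partial i sqd = fun x => 2 * (x - p) 0 i.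
Proof.
have C i := Ck1M (Ck1_disp i).1 (Ck1_disp i).1.
have [C1 E1] := Ck1_sum (fun i => (C i).1); split=> // i.
rewrite /sqd /dotv E1; apply/funext => x; rewrite (bigD1 i)//= big1 => [|j ji].
  by rewrite (C i).2 (Ck1_disp i).2 eqxx addr0 mulr1 mulr2n mulrDl mul1r.
by rewrite (C j).2 (Ck1_disp j).2 eq_sym (negbTE ji) mulr0 addr0.
Qed.

Lemma continuous_sqd : continuous sqd.
Proof. exact: Ck1_continuous Ck1_sqd.1. Qed.

Lemma grad_sqd_chain (h dh : R -> R) : (forall t, is_derive t (1 : R) h (dh t)) ->
  continuous dh -> Ck 1 (fun x => h (sqd x)) /\
  forall x, grad (fun x => h (sqd x)) x = (2 * dh (sqd x)) *: (x - p).
Proof.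
move=> hE cdh; have [C E] := Ck1_chain Ck1_sqd.1 hE cdh; split=> // x.
by apply/rowP => i; rewrite [LHS]mxE E Ck1_sqd.2 [RHS]mxE mulrCA mulrA.
Qed.

(** The half-side 1 + B avoids a square root: if t^2 <= B, then either |t| <= 1 or |t| <= t^2 <= B.
    The sup norm [|p|] accounts for the center. *)
Lemma sqd_cube B x : sqd x <= B -> cube (1 + B + `|p|) x.
Proof.
move=> xB; apply/cubeP => i.
have B0 : 0 <= B by exact: le_trans (sqd_ge0 x) xB.
rewrite -(subrK (p 0 i) (x 0 i)) (le_trans (ler_normD _ _))// lerD//; last first.
  by rewrite [leRHS]/Num.norm /= mx_normrE;
     apply: (le_bigmax _ (fun ij => `|p ij.1 ij.2|) (0, i)).
have : (x 0 i - p 0 i) ^+ 2 <= B.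
  apply: le_trans xB; rewrite /sqd /dotv (bigD1 i)//= !mxE -expr2 lerDl.
  by apply: sumr_ge0 => j _; rewrite -expr2 sqr_ge0.
rewrite -real_normK ?num_real// => h.
have [h1|h1] := leP `|x 0 i - p 0 i| 1.
  by rewrite (le_trans h1)// lerDl.
by apply: (le_trans _ (ler_wpDl ler01 h)); rewrite expr2 ler_peMl// ltW.
Qed.

Lemma dotvC x y : dotv x y = dotv y x :> R.
Proof. by apply: eq_bigr => i _; rewrite mulrC. Qed.

Lemma dotvZl a x y : dotv (a *: x) y = a * dotv x y :> R.
Proof. by rewrite /dotv mulr_sumr; apply: eq_bigr => i _; rewrite mxE mulrA. Qed.

Lemma dotvDr x y z : dotv x (y + z) = dotv x y + dotv x z :> R.
Proof. by rewrite /dotv -big_split; apply: eq_bigr => i _; rewrite mxE mulrDr. Qed.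

Lemma dotvDl x y z : dotv (y + z) x = dotv y x + dotv z x :> R.
Proof. by rewrite dotvC dotvDr !(dotvC x). Qed.

Lemma dotv_ge0 x : 0 <= dotv x x.
Proof. by apply: sumr_ge0 => i _; rewrite -expr2 sqr_ge0. Qed.

Lemma cauchy_schwarz x y : dotv x y <= enorm x * enorm y.
Proof.
have e2 (z : 'rV[R]_n) : enorm z ^+ 2 = dotv z z by rewrite sqr_sqrtr// dotv_ge0.
have [x0|x0] := eqVneq (enorm x) 0.
  have : dotv x x == 0 by rewrite -e2 x0 expr0n.
  rewrite /dotv psumr_eq0 => [/allP xi|i _]; last by rewrite -expr2 sqr_ge0.
  rewrite x0 mul0r big1// => i _; have := xi i (mem_index_enum _).
  by rewrite /= mulf_eq0 orbb => /eqP ->; rewrite mul0r.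
have ex : 0 < enorm x by rewrite lt_def x0 enorm_ge0.
(* With X = |x| and Y = |y|, the expansion of |Y x - X y|^2 is 2 X Y (X Y - x . y). *)
have := dotv_ge0 (enorm y *: x + (- enorm x) *: y).
rewrite dotvDl !dotvDr !dotvZl ![dotv _ (_ *: _)]dotvC !dotvZl -!e2 (dotvC y x).
have [y0|y0] := eqVneq (enorm y) 0.
  rewrite y0 => _; have : dotv y y == 0 by rewrite -e2 y0 expr0n.
  rewrite /dotv psumr_eq0 => [/allP yi|i _]; last by rewrite -expr2 sqr_ge0.
  rewrite mulr0 big1// => i _; have := yi i (mem_index_enum _).
  by rewrite /= mulf_eq0 orbb => /eqP ->; rewrite mulr0.
have ey : 0 < enorm y by rewrite lt_def y0 enorm_ge0.
set X := enorm x in ex *; set Y := enorm y in ey *; set d := dotv x y => h.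
rewrite -subr_ge0 -(pmulr_rge0 _ (mulr_gt0 ex ey)); nra.
Qed.

Lemma enormD x y : enorm (x + y) <= enorm x + enorm y.
Proof.
have e2 (z : 'rV[R]_n) : enorm z ^+ 2 = dotv z z by rewrite sqr_sqrtr// dotv_ge0.
rewrite -(@ler_pXn2r _ 2)// ?nnegrE ?addr_ge0 ?enorm_ge0//.
rewrite e2 dotvDl !dotvDr (dotvC y x) -!e2; have := cauchy_schwarz x y.
set d := dotv x y; set X := enorm x; set Y := enorm y; nra.
Qed.

Lemma enormN x : enorm (- x) = enorm x.
Proof.
by rewrite /enorm -scaleN1r dotvZl dotvC dotvZl mulrA mulrNN mulr1 mul1r.
Qed.

End divergence_rules.

Section limits_of_integrals.
Context {R : realType} {n : nat}.
Local Notation leb := (lebesgue_rV _).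

(** Convergence is asked as eventual equality at each point, which is what the cutoffs provide; the
    dominating function is C on the cube and 0 elsewhere. *)
Lemma cube_dominated_convergence (M C : R) (F_ : nat -> 'rV[R]_n -> R)
    (F : 'rV[R]_n -> R) :
  (forall m, measurable_fun setT (F_ m)) ->
  (forall m x, `|F_ m x| <= C) -> (forall m x, ~ cube M x -> F_ m x = 0) ->
  (forall x, \forall m \near \oo, F_ m x = F x) ->
  (fun m => \int[leb]_x (F_ m x)%:E)%E @ \oo --> (\int[leb]_x (F x)%:E)%E.
Proof.
move=> mF_ F_C F_0 F_F.
have cv x : (fun m => F_ m x) @ \oo --> F x.
  by apply: cvg_near_cst; exact: F_F.
pose g (x : 'rV[R]_n) : R := if `[< cube M x >] then C else 0.
have mg : measurable_fun setT g.
  apply: measurable_fun_ifT => //; apply: (measurable_fun_bool true).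
  rewrite setTI (_ : _ @^-1` _ = cube M); first exact: measurable_box.
  by apply/seteqP; split => x; [move/asboolP|move=> ?; exact/asboolP].
have C0 : 0 <= C by apply: le_trans (F_C 0 0).
have ig : leb.-integrable setT (EFin \o g).
  apply: (@bounded_integrable_cube _ _ M C) => //.
    by move=> x; rewrite /g; case: ifP => _; rewrite ?normr0// ger0_norm.
  by move=> x xM; rewrite /g asboolF.
have := @dominated_cvg _ _ _ leb setT measurableT (fun m => EFin \o F_ m)
  (EFin \o F) (EFin \o g); apply => //.
- by move=> m; exact/measurable_EFinP.
- by move=> x _; apply: cvg_EFin; [near=> m|exact: cv].
- move=> m x _; rewrite /= lee_fin /g; case: asboolP => // xM.
  by rewrite F_0// normr0.
Unshelve. all: by end_near. Qed.

End limits_of_integrals.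

(** * Upper bound for the integral of a divergence over a ball *)

Section ball_fields.
Context {R : realType} {n : nat}.
Variables (p : 'rV[R]_n) (r : R).
Hypothesis r0 : 0 < r.
Local Notation leb := (lebesgue_rV _).

Definition cball : set 'rV[R]_n := [set x | sqd p x <= r ^+ 2].

Lemma closed_cball : closed cball.
Proof.
have := @closed_comp _ _ (sqd p) [set y | y <= r ^+ 2].
by apply=> [x _|]; [exact: continuous_sqd|exact: closed_le].
Qed.

Lemma measurable_cball : measurable cball.
Proof. exact: closed_rV_measurable closed_cball. Qed.

Lemma lebesgue_cball_lty : (leb cball < +oo)%E.
Proof.
apply: le_lt_trans (lebesgue_rV_box_lty (const_mx (- (1 + r ^+ 2 + `|p|)))
  (const_mx (1 + r ^+ 2 + `|p|))).
apply: le_measure; rewrite ?inE; [exact: measurable_cball|exact: measurable_box|].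
by move=> x; exact: sqd_cube.
Qed.

Definition width (m : nat) : R := m.+1%:R^-1.

Lemma width_gt0 m : 0 < width m. Proof. by rewrite invr_gt0. Qed.

Lemma width_le1 m : width m <= 1.
Proof. by rewrite invf_le1// ler1n. Qed.

(** The transition layer from r^2 to r^2 + width lies outside the closed ball and shrinks, so each
    point ends up on one side of it. The derivatives become 0 at every point, although no bound
    holds for all of them. *)
Lemma near_cutoff s :
  \forall m \near \oo, cutoff (r ^+ 2) (width m) s = ((s <= r ^+ 2)%R)%:R /\
    dcutoff (r ^+ 2) (width m) s = 0.
Proof.
have [sr|sr] := leP s (r ^+ 2).
  by near=> m; rewrite cutoff_le ?dcutoff_le//; exact: width_gt0.
have d0 : 0 < s - r ^+ 2 by rewrite subr_gt0.
near=> m; have ms : r ^+ 2 + width m <= s.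
  by rewrite -lerBrDl ltW//; near: m; exact: near_infty_natSinv_lt (PosNum d0).
by rewrite cutoff_ge ?dcutoff_ge//; exact: width_gt0.
Unshelve. all: by end_near. Qed.

Lemma Ck1_cutoff m : Ck 1 (fun x => cutoff (r ^+ 2) (width m) (sqd p x)) /\
  forall x, grad (fun x => cutoff (r ^+ 2) (width m) (sqd p x)) x =
    (2 * dcutoff (r ^+ 2) (width m) (sqd p x)) *: (x - p).
Proof.
apply: grad_sqd_chain => [t|]; first by apply: is_derive_cutoff; exact: width_gt0.
by apply: continuous_dcutoff; exact: width_gt0.
Qed.

Lemma cutoff_cube m x : ~ cube (1 + (r ^+ 2 + 1) + `|p|) x ->
  cutoff (r ^+ 2) (width m) (sqd p x) = 0.
Proof.
move=> xM; apply: cutoff_ge; first exact: width_gt0.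
rewrite leNgt; apply/negP => h; apply: xM; apply: sqd_cube.
by rewrite (le_trans (ltW h))// lerD2l width_le1.
Qed.

(* The fields w (Phi - (x - p) / r), with w cutoffs decreasing to the indicator
   of the ball, have divergence at least w (div Phi - n / r) because Phi . (x - p)
   does not exceed |x - p| <= |x - p|^2 / r where w is not constant. *)
Lemma integral_divergence_cball (Phi : 'rV[R]_n -> 'rV[R]_n) :
  C1_field Phi -> (forall x, enorm (Phi x) <= 1) ->
  (\int[leb]_(x in cball) (divergence Phi x)%:E <= (n%:R / r)%:E * leb cball)%E.
Proof.
move=> CPhi Phi1.
(* This is the cube of [sqd_cube] for B = r^2 + 1; it contains the supports of all the cutoffs,
   whose widths are at most 1. *)
pose M := 1 + (r ^+ 2 + 1) + `|p|.
pose w m x := cutoff (r ^+ 2) (width m) (sqd p x).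
pose Psi x := Phi x + (- r^-1) *: (x - p).
pose G x := divergence Phi x - n%:R / r.
have cst_r := (@Ck1_cst R n (- r^-1)).1.
have CPsi : C1_field Psi.
  by apply: C1_field_add => //; apply: C1_field_scale => //; exact: C1_disp.
have divPsi x : divergence Psi x = G x.
  rewrite divergence_add//; last by apply: C1_field_scale => //; exact: C1_disp.
  rewrite divergence_scale//; last exact: C1_disp.
  rewrite divergence_disp /dotv big1 ?addr0 => [|i _].
    by rewrite /G mulNr mulrC.
  by rewrite mxE (@Ck1_cst R n (- r^-1)).2 mul0r.
have Cw m := (Ck1_cutoff m).1.
have Cfield m : C1_field (fun x => w m x *: Psi x) by exact: C1_field_scale (Cw m) CPsi.
have wPsi0 m x : ~ cube M x -> w m x *: Psi x = 0.
  by move=> xM; rewrite /w cutoff_cube// scale0r.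
have D m := integral_divergence_cube (Cfield m) (wPsi0 m).
have cG : continuous G.
  have cd := continuous_divergence CPhi.
  by move=> x; exact: (cvgB (cd x) (cvg_cst _)).
have GD m x : w m x * G x <= divergence (fun x => w m x *: Psi x) x.
  rewrite (divergence_scale x (Cw m) CPsi).
  rewrite divPsi lerDl (Ck1_cutoff m).2 dotvZl.
  have w0 := width_gt0 m; have d0 := dcutoff_le0 (r ^+ 2) w0 (sqd p x).
  have [s1|s1] := leP (sqd p x) (r ^+ 2); first by rewrite dcutoff_le// mulr0 mul0r.
  apply: mulr_le0; first by rewrite mulr_ge0_le0.
  rewrite /Psi dotvDr [dotv _ (_ *: _)]dotvC dotvZl.
  rewrite mulNr subr_le0 -/(sqd p x) -enorm_sqd.
  have rs : r <= enorm (x - p).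
    rewrite leNgt; apply/negP => h; move: s1; rewrite -enorm_sqd ltNge.
    by rewrite ler_pXn2r ?nnegrE ?enorm_ge0 ?ltW.
  have e0 := enorm_ge0 (x - p).
  rewrite (le_trans (cauchy_schwarz _ _))// ler_pdivlMl//.
  by rewrite mulrCA expr2 ler_wpM2l// (le_trans _ rs)// ler_piMr ?(ltW r0).
have cw m : continuous (w m) := Ck1_continuous (Cw m).
have wG0 m x : ~ cube M x -> w m x * G x = 0.
  by move=> xM; rewrite /w cutoff_cube// mul0r.
have iwG m : leb.-integrable setT (EFin \o (fun x => w m x * G x)).
  exact: continuous_cube_integrable (continuous_mul (cw m) cG) (wG0 m).
have wGle0 m : (\int[leb]_x (w m x * G x)%:E <= 0)%E.
  rewrite -(D m).2; apply: le_integral; [by []|exact: iwG|exact: (D m).1|].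
  by move=> x _; rewrite lee_fin GD.
have [C GC] : exists C, forall x, cube M x -> `|G x| <= C.
  have /compact_bounded[C [_ FC]] : compact (G @` cube M).
    by apply: continuous_compact; [exact: continuous_subspaceT|exact: compact_cube].
  exists (`|C| + 1) => x Mx.
  by apply: (FC (`|C| + 1)); [rewrite ltr_pwDr// ler_norm|exists x].
pose F x := ((sqd p x <= r ^+ 2)%R)%:R * G x.
have wGC m x : `|w m x * G x| <= `|C|.
  have [Mx|/(wG0 m) ->] := pselect (cube M x); last by rewrite normr0.
  rewrite normrM ger0_norm ?cutoff_ge0// (le_trans _ (ler_norm C))//.
  by rewrite (le_trans _ (GC x Mx))// ler_piMl// cutoff_le1.
have wF x : \forall m \near \oo, w m x * G x = F x.
  by apply: filterS (near_cutoff (sqd p x)) => m [h _]; rewrite /w h.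
have mw m := continuous_rV_measurable (continuous_mul (cw m) cG).
have cvF := cube_dominated_convergence mw wGC wG0 wF.
have : (\int[leb]_x (F x)%:E <= 0)%E.
  rewrite -(cvg_lim _ cvF)//; apply: lime_le; first by apply/cvg_ex; eexists; exact: cvF.
  by near=> m; exact: wGle0.
have -> : (\int[leb]_x (F x)%:E = \int[leb]_(x in cball) (G x)%:E)%E.
  rewrite [RHS]integral_mkcond; apply: eq_integral => x _.
  rewrite patchE /F; case: ifPn => xB; first by rewrite inE /cball/= in xB; rewrite xB mul1r.
  rewrite (negbTE (_ : ~~ (sqd p x <= r ^+ 2))) ?mul0r//.
  by apply: contra xB => xB; rewrite inE.
have iG : leb.-integrable cball (EFin \o G).
  apply: (@integrableS _ _ _ _ (cube M)) => //;
    [exact: measurable_box|exact: measurable_cball| |].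
    by move=> x xB; apply: sqd_cube; rewrite (le_trans xB)// lerDl.
  apply: measurable_bounded_integrable; [exact: measurable_box|exact: lebesgue_rV_box_lty| |].
    by apply: measurable_funTS; exact: continuous_rV_measurable.
  exists C; split; first exact: num_real.
  by move=> t Ct x Mx; exact: le_trans (GC _ Mx) (ltW Ct).
have ic : leb.-integrable cball (EFin \o cst (n%:R / r)).
  apply: measurable_bounded_integrable;
    [exact: measurable_cball|exact: lebesgue_cball_lty|exact: measurable_cst|].
  exists `|n%:R / r|; split; first exact: num_real.
  by move=> t Ct x _; exact: ltW.
rewrite (_ : (\int[leb]_(x in cball) (divergence Phi x)%:E =
    \int[leb]_(x in cball) ((EFin \o G) x + (EFin \o cst (n%:R / r)%R) x))%E).
  rewrite integralD//; [|exact: measurable_cball].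
  have -> : (\int[leb]_(x in cball) (EFin \o cst (n%:R / r)%R) x =
      (n%:R / r)%:E * leb cball)%E.
    exact: (integral_cst leb measurable_cball (n%:R / r)%:E).
  by move=> G0; rewrite -[leRHS]add0e leeD2r.
by apply: eq_integral => x _; rewrite /= -EFinD /G subrK.
Unshelve. all: by end_near. Qed.

End ball_fields.

(** * The radial profile of z and its C^1 approximations *)

Section calibration_profile.
Context {R : realType} (n : nat) (r : R).
Hypothesis r0 : 0 < r.

Let a : R := r ^+ 2.
Let a0 : 0 < a. Proof. exact: exprn_gt0. Qed.

(* kappa solves n f + 2 s f' = 0: the field kappa(|x - p|^2) (x - p) is
   divergence free, and its norm is 1 for |x - p| = r. *)
Definition kappa (s : R) : R := r^-1 * (s / r ^+ 2) `^ (- (n%:R / 2)).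

Definition prof_lim (s : R) : R := if s <= r ^+ 2 then r^-1 else kappa s.

(** The constant branch near the center removes the singularity of [kappa] at 0, whose coefficient
    is 0 there. *)
Definition prof (m : nat) (s : R) : R :=
  cutoff (r ^+ 2) (width m) s * r^-1 + (1 - cutoff (r ^+ 2) (width m) s) * kappa s.

Definition dprof (m : nat) (s : R) : R :=
  dcutoff (r ^+ 2) (width m) s * (r^-1 - kappa s)
  - (1 - cutoff (r ^+ 2) (width m) s) * (n%:R / 2 * kappa s / s).

Lemma is_derive_kappa (s : R) : 0 < s ->
  is_derive s (1 : R) kappa (- (n%:R / 2 * kappa s / s)).
Proof.
move=> s0; have y0 : 0 < s / r ^+ 2 by rewrite divr_gt0.
have d1 : is_derive s (1 : R) (fun s : R => s / r ^+ 2) (r ^+ 2)^-1.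
  apply: is_derive_eq (is_deriveM (is_derive_id s (1 : R))
    (is_derive_cst (r ^+ 2)^-1 s (1 : R))) _.
  by rewrite scaler0 add0r [_ *: _]mulr1.
have d2 := @is_derive1_comp _ _ _ s _ _ (is_derive1_powR (- (n%:R / 2)) y0) d1.
apply: is_derive_eq (is_deriveM (is_derive_cst r^-1 s (1 : R)) d2) _.
rewrite scaler0 addr0 powRB; last by apply/implyP => _; rewrite gt_eqF.
rewrite powRr1 ?(ltW y0)// /kappa /cst /GRing.scale /=.
by field; rewrite !gt_eqF.
Qed.

Lemma kappa_ge0 s : 0 <= kappa s.
Proof. by rewrite mulr_ge0 ?powR_ge0// invr_ge0 ltW. Qed.

Lemma kappa_le s : r ^+ 2 <= s -> kappa s <= r^-1.
Proof.
move=> rs; have y1 : 1 <= s / r ^+ 2 by rewrite ler_pdivlMr// mul1r.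
rewrite /kappa ler_piMr ?invr_ge0 ?(ltW r0)//.
by rewrite -[leRHS](powRr0 (s / r ^+ 2)) ler_powR// oppr_le0 divr_ge0.
Qed.

(** With y = s / r^2, this is y^(-n/2) = exp(-(n/2) ln y) >= 1 - (n/2) ln y >= 1 - (n/2) (y - 1):
    the gap between the two branches is at most linear in the distance of s to r^2. *)
Lemma kappa_ge s : r ^+ 2 <= s ->
  r^-1 - kappa s <= r^-1 * (n%:R / 2) * (s / r ^+ 2 - 1).
Proof.
move=> rs; have y1 : 1 <= s / r ^+ 2 by rewrite ler_pdivlMr// mul1r.
rewrite /kappa -[X in X - _]mulr1 -mulrBr -mulrA ler_wpM2l ?invr_ge0 ?(ltW r0)//.
rewrite lerBlDr -lerBlDl; have y0 : 0 < s / r ^+ 2 by exact: lt_le_trans y1.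
rewrite /powR gt_eqF// (le_trans _ (expR_ge1Dx _))// lerD2l mulNr lerN2.
rewrite ler_wpM2l ?divr_ge0// -[X in ln X](subrKC 1) le_ln1Dx//.
by rewrite ltrBrDl subrr.
Qed.

Lemma is_derive_prof m (s : R) : is_derive s (1 : R) (prof m) (dprof m s).
Proof.
have w0 := @width_gt0 R m.
(* Below r^2 the profile is locally constant; this settles s <= 0, where [is_derive_kappa] does not
   apply. *)
have [sa|sa] := ltP s (r ^+ 2).
  rewrite /dprof dcutoff_le ?ltW// cutoff_le ?ltW// mul0r subrr mul0r subrr.
  apply: (@near_eq_is_derive _ _ _ (cst r^-1)).
  near=> t; have ta : t <= r ^+ 2 by rewrite ltW//; near: t; exact: lt_nbhsl.
  by rewrite /prof cutoff_le// subrr mul0r mul1r addr0.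
have s0 : 0 < s by exact: lt_le_trans sa.
have dc := is_derive_cutoff (r ^+ 2) (width m) s; have dk := is_derive_kappa s0.
have d1 := is_deriveM dc (is_derive_cst r^-1 s (1 : R)).
have d2 := is_deriveM (is_deriveB (is_derive_cst (1 : R) s (1 : R)) dc) dk.
apply: is_derive_eq (is_deriveD d1 d2) _.
by rewrite /dprof /cst /GRing.scale /= !fctE; ring.
Unshelve. all: by end_near. Qed.

Lemma continuous_prof m : continuous (prof m).
Proof.
by move=> s; apply/differentiable_continuous/derivable1_diffP;
   case: (is_derive_prof m s).
Qed.

Lemma continuous_dprof m : continuous (dprof m).
Proof.
have w0 := @width_gt0 R m.
move=> s; have [sa|sa] := ltP s (r ^+ 2).
  have E t : t <= r ^+ 2 -> dprof m t = 0.
    move=> ta; rewrite /dprof dcutoff_le// cutoff_le// mul0r subrr mul0r.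
    by rewrite subrr.
  rewrite /continuous_at (E s) ?ltW//; apply: cvg_near_cst.
  by near=> t; rewrite E// ltW//; near: t; exact: lt_nbhsl.
have s0 : 0 < s by exact: lt_le_trans sa.
have cd : {for s, continuous (dcutoff (r ^+ 2) (width m))} by exact: continuous_dcutoff.
have cc : {for s, continuous (cutoff (r ^+ 2) (width m))}.
  apply/differentiable_continuous/derivable1_diffP.
  by case: (is_derive_cutoff (r ^+ 2) (width m) s).
have ck : {for s, continuous kappa}.
  apply/differentiable_continuous/derivable1_diffP.
  by case: (is_derive_kappa s0).
have ci : {for s, continuous (fun t : R => t^-1)}.
  by apply: inv_continuous; rewrite gt_eqF.
apply: cvgB; first by apply: cvgM => //; apply: cvgB => //; exact: cvg_cst.
apply: cvgM; first by apply: cvgB => //; exact: cvg_cst.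
by apply: cvgM => //; apply: cvgM => //; exact: cvg_cst.
Unshelve. all: by end_near. Qed.

Lemma prof_ge0 m s : 0 <= prof m s.
Proof.
by rewrite addr_ge0// mulr_ge0 ?cutoff_ge0 ?kappa_ge0 ?invr_ge0 ?subr_ge0 ?cutoff_le1 ?ltW.
Qed.

Lemma prof_le m s : prof m s <= r^-1.
Proof.
have [sa|/ltW sa] := leP s (r ^+ 2).
  by rewrite /prof cutoff_le ?width_gt0// subrr mul0r mul1r addr0.
have := cutoff_ge0 (r ^+ 2) (width m) s; have := cutoff_le1 (r ^+ 2) (width m) s.
have := kappa_le sa; rewrite /prof; nra.
Qed.

Lemma near_prof s : \forall m \near \oo, prof m s = prof_lim s.
Proof.
apply: filterS (near_cutoff r s) => m [h _]; rewrite /prof /prof_lim h.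
by case: leP => _; rewrite ?subrr ?subr0 ?mul0r ?mul1r ?addr0 ?add0r.
Qed.

(* The divergence of the field f(|x - p|^2) (x - p), for f = prof m, at a point
   where |x - p|^2 = s. *)
Definition dprof_div m s : R := n%:R * prof m s + 2 * s * dprof m s.

(** The equation n f + 2 s f' = 0 satisfied by [kappa] cancels the terms in 1 - [cutoff]; what
    remains besides the expected limit is the derivative of the cutoff times the gap between the
    branches. The point s = 0 is apart because [dprof] divides by s. *)
Lemma dprof_divE m s :
  dprof_div m s = n%:R / r * cutoff (r ^+ 2) (width m) s
    + 2 * s * (dcutoff (r ^+ 2) (width m) s * (r^-1 - kappa s)).
Proof.
rewrite /dprof_div /prof /dprof; have [->|s0] := eqVneq s 0.
  rewrite cutoff_le ?width_gt0// ?(ltW a0)//; ring.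
by field; rewrite s0 gt_eqF.
Qed.

Lemma near_dprof_div s :
  \forall m \near \oo, dprof_div m s = n%:R / r * ((s <= r ^+ 2)%R)%:R.
Proof.
apply: filterS (near_cutoff r s) => m [h1 h2].
by rewrite dprof_divE h1 h2 mul0r mulr0 addr0.
Qed.

(** The bound must not depend on m. On the transition layer the derivative of the cutoff is at most
    4 / width, while [kappa_ge] bounds the gap by a multiple of the width: the widths cancel. *)
Lemma dprof_div_bounded m s :
  `|dprof_div m s| <= n%:R / r + 4 * (r ^+ 2 + 1) * n%:R / r ^+ 3.
Proof.
have w0 := @width_gt0 R m; have w1 := @width_le1 R m.
have nr0 : 0 <= n%:R / r by rewrite divr_ge0// ltW.
have C0 : 0 <= 4 * (r ^+ 2 + 1) * n%:R / r ^+ 3.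
  apply: divr_ge0; last exact: exprn_ge0 (ltW r0).
  by apply: mulr_ge0 => //; apply: mulr_ge0 => //; apply: addr_ge0 => //; exact: ltW.
rewrite dprof_divE (le_trans (ler_normD _ _))// lerD//.
  by rewrite normrM !ger0_norm ?cutoff_ge0// ler_piMr// cutoff_le1.
have [sa|/ltW sa] := leP s (r ^+ 2); first by rewrite dcutoff_le// mul0r mulr0 normr0.
have [sb|/ltW sb] := leP (r ^+ 2 + width m) s.
  by rewrite dcutoff_ge// mul0r mulr0 normr0.
have s0 : 0 < s by exact: lt_le_trans sa.
have k0 : 0 <= r^-1 - kappa s by rewrite subr_ge0 kappa_le.
rewrite normrM (normrM 2) (normrM (dcutoff _ _ _)) (ger0_norm (ltW s0)).
rewrite (ger0_norm k0) (@ger0_norm _ 2)//.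
have h1 := normr_dcutoff (r ^+ 2) w0 s.
have h2 : r^-1 - kappa s <= r^-1 * (n%:R / 2) * (width m / r ^+ 2).
  rewrite (le_trans (kappa_ge sa))// ler_wpM2l ?mulr_ge0 ?invr_ge0 ?(ltW r0)//.
  by rewrite lerBlDl -(mulfV (lt0r_neq0 a0)) -mulrDl ler_pM2r ?invr_gt0.
have h3 : s <= r ^+ 2 + 1 by rewrite (le_trans sb)// lerD2l.
have -> : 4 * (r ^+ 2 + 1) * n%:R / r ^+ 3 =
    2 * (r ^+ 2 + 1) * (4 / width m * (r^-1 * (n%:R / 2) * (width m / r ^+ 2))).
  by field; rewrite !gt_eqF.
apply: ler_pM; [by rewrite mulr_ge0// ltW|by rewrite mulr_ge0| |].
  by rewrite ler_wpM2l.
exact: ler_pM.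
Qed.

Lemma prof_lim_ge0 s : 0 <= prof_lim s.
Proof. by rewrite /prof_lim; case: ifP => _; rewrite ?kappa_ge0// invr_ge0 ltW. Qed.

Lemma prof_lim_le s : prof_lim s <= r^-1.
Proof. by have [m _ /(_ m (leqnn m)) <-] := near_prof s; exact: prof_le. Qed.

(** This is |z|^2 <= 1. Outside the ball, n >= 2 makes the exponent -n/2 at most -1, so [kappa] s <=
    r / s and the product is at most r^2 / s <= 1. *)
Lemma prof_lim_sqr s : (2 <= n)%N -> 0 <= s -> prof_lim s ^+ 2 * s <= 1.
Proof.
move=> n2 s0; rewrite /prof_lim; have [sa|/ltW sa] := leP s (r ^+ 2).
  by rewrite exprVn mulrC ler_pdivrMr// mul1r.
have y1 : 1 <= s / r ^+ 2 by rewrite ler_pdivlMr// mul1r.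
have y0 : 0 < s / r ^+ 2 by exact: lt_le_trans y1.
have kl : kappa s <= r^-1 * (s / r ^+ 2)^-1.
  rewrite /kappa ler_wpM2l // ?invr_ge0 ?(ltW r0)// -(powR_inv1 (ltW y0)).
  by rewrite ler_powR// lerN2 ler_pdivlMr// mul1r ler_nat.
have sp : 0 < s by exact: lt_le_trans sa.
apply: (@le_trans _ _ ((r^-1 * (s / r ^+ 2)^-1) ^+ 2 * s)).
  by rewrite ler_wpM2r// ler_pXn2r// nnegrE ?kappa_ge0// (le_trans _ kl)// kappa_ge0.
have -> : (r^-1 * (s / r ^+ 2)^-1) ^+ 2 * s = (s / r ^+ 2)^-1.
  by field; rewrite !gt_eqF.
by rewrite invf_le1.
Qed.

End calibration_profile.

(** * The field z and its weak divergence *)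

Section calibration_field.
Context {R : realType} {n : nat}.
Variables (p : 'rV[R]_n) (r : R).
Hypothesis r0 : 0 < r.
Local Notation leb := (lebesgue_rV _).

Definition calib (x : 'rV[R]_n) : 'rV[R]_n := (- prof_lim n r (sqd p x)) *: (x - p).

Lemma measurable_prof_lim : measurable_fun setT (fun x => prof_lim n r (sqd p x)).
Proof.
apply: (@measurable_fun_cvg _ _ _ _ (fun m x => prof n r m (sqd p x))).
  move=> m; apply: continuous_rV_measurable.
  by apply: continuous_compR; [exact: continuous_sqd|exact: continuous_prof].
by move=> x _; apply: cvg_near_cst; exact: near_prof.
Qed.

Lemma measurable_calib : measurable_fun setT calib.
Proof.
apply/measurable_fun_rVP => i.
rewrite (_ : (fun _ => _) = fun x => - prof_lim n r (sqd p x) * (x - p) 0 i).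
  apply: measurable_funM; first by apply: measurable_funN; exact: measurable_prof_lim.
  exact: continuous_rV_measurable (Ck1_continuous (Ck1_disp p i).1).
by apply/funext => x; rewrite mxE.
Qed.

Lemma enorm_calib x : (2 <= n)%N -> enorm (calib x) <= 1.
Proof.
move=> n2; rewrite /enorm -[leRHS]sqrtr1; apply: ler_wsqrtr.
rewrite /calib dotvZl dotvC dotvZl mulrA mulrNN -expr2.
exact: (prof_lim_sqr r0 n2 (sqd_ge0 p x)).
Qed.

(** The divergence theorem for the C^1 fields phi f(|x - p|^2) (x - p), f = [prof] m, says that the
    integral of f grad phi . (x - p) + phi (n f + 2 s f') is 0. In the limit the first term becomes
    -z . grad phi and the second (n / r) 1_B phi. *)
Lemma calib_weak_div (M : R) (phi : 'rV[R]_n -> R) :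
  Ck 1 phi -> (forall x, ~ cube M x -> phi x = 0) ->
  leb.-integrable setT (fun x => (n%:R / r * \1_(cball p r) x * phi x)%:E) /\
  (\int[leb]_x (dotv (calib x) (grad phi x))%:E =
   \int[leb]_x (n%:R / r * \1_(cball p r) x * phi x)%:E)%E.
Proof.
move=> Cphi phi0.
pose h m x := prof n r m (sqd p x).
have Ch m : Ck 1 (h m) /\ forall x, grad (h m) x = (2 * dprof n r m (sqd p x)) *: (x - p).
  apply: grad_sqd_chain => [t|]; first exact: is_derive_prof.
  exact: continuous_dprof.
have Cf m : Ck 1 (fun x => phi x * h m x) := (Ck1M Cphi (Ch m).1).1.
have Cfield m : C1_field (fun x => (phi x * h m x) *: (x - p)).
  exact: C1_field_scale (Cf m) (C1_disp p).
have f0 m x : ~ cube M x -> (phi x * h m x) *: (x - p) = 0.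
  by move=> /phi0 ->; rewrite mul0r scale0r.
have D m := integral_divergence_cube (Cfield m) (f0 m).
pose q x := dotv (grad phi x) (x - p).
have divE m x : divergence (fun x => (phi x * h m x) *: (x - p)) x =
    h m x * q x + phi x * dprof_div n r m (sqd p x).
  rewrite (divergence_scale x (Cf m) (C1_disp p)) divergence_disp.
  have -> : grad (fun x => phi x * h m x) x =
      (phi x) *: grad (h m) x + (h m x) *: grad phi x.
    apply/rowP => i; rewrite [LHS]mxE (Ck1M Cphi (Ch m).1).2 [RHS]mxE.
    rewrite [X in _ = X + _]mxE [X in _ = _ + X]mxE.
    by rewrite [grad (h m) x 0 i]mxE [grad phi x 0 i]mxE.
  rewrite dotvDl !dotvZl (Ch m).2 dotvZl -/(q x) -/(sqd p x) /dprof_div -/(h m x).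
  ring.
have grad0 x : ~ cube M x -> grad phi x = 0.
  by move=> xM; apply/rowP => i; rewrite !mxE; exact: derive_off_cube phi0 xM.
have q0 x : ~ cube M x -> q x = 0.
  move=> /grad0 xM; rewrite /q xM /dotv big1// => i _; by rewrite mxE mul0r.
have cq : continuous q.
  apply: continuous_sum_ord => i; apply: continuous_mul; last first.
    exact: Ck1_continuous (Ck1_disp p i).1.
  rewrite (_ : (fun _ => _) = partial i phi); first exact: Ck1_continuous_partial.
  by apply/funext => x; rewrite mxE.
have [Cq qC] := continuous_cube_bounded cq q0.
have [Cp pC] := continuous_cube_bounded (Ck1_continuous Cphi) phi0.
pose F1 x := prof_lim n r (sqd p x) * q x.
pose F2 x := n%:R / r * \1_(cball p r) x * phi x.
pose Cd := n%:R / r + 4 * (r ^+ 2 + 1) * n%:R / r ^+ 3.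
pose G m x := h m x * q x + phi x * dprof_div n r m (sqd p x).
have G0 m x : ~ cube M x -> G m x = 0.
  by move=> xM; rewrite /G q0// phi0// mulr0 mul0r addr0.
have GC m x : `|G m x| <= r^-1 * Cq + Cp * Cd.
  rewrite (le_trans (ler_normD _ _))// lerD// normrM ler_pM//.
    by rewrite ger0_norm ?prof_ge0// prof_le.
  exact: dprof_div_bounded.
have GF x : \forall m \near \oo, G m x = F1 x + F2 x.
  apply: filterS2 (near_prof n r (sqd p x)) (near_dprof_div n r0 (sqd p x)) => m h1 h2.
  have -> : F2 x = n%:R / r * ((sqd p x <= r ^+ 2)%R)%:R * phi x.
    rewrite /F2 indicE (_ : (x \in cball p r) = (sqd p x <= r ^+ 2))//.
    by apply/idP/idP; rewrite inE.
  by rewrite /G /h h1 h2 [phi x * _]mulrC.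
have GE m : G m = divergence (fun x => (phi x * h m x) *: (x - p)).
  by apply/funext => x; rewrite divE.
have mG m : measurable_fun setT (G m).
  by rewrite GE; apply: continuous_rV_measurable; exact: continuous_divergence.
have cvG := cube_dominated_convergence mG GC G0 GF.
have mF1 : measurable_fun setT F1.
  by apply: measurable_funM; [exact: measurable_prof_lim|exact: continuous_rV_measurable].
have iF1 : leb.-integrable setT (EFin \o F1).
  apply: (@bounded_integrable_cube _ _ M (r^-1 * Cq)) => // x.
    by rewrite normrM ler_pM// ger0_norm ?prof_lim_ge0// prof_lim_le.
  by move=> xM; rewrite /F1 q0// mulr0.
have iF2 : leb.-integrable setT (EFin \o F2).
  apply: (@bounded_integrable_cube _ _ M (n%:R / r * Cp)).
  - apply: measurable_funM; last exact: continuous_rV_measurable (Ck1_continuous Cphi).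
    apply: measurable_funM; first exact: measurable_cst.
    exact: measurable_indic (measurable_cball p r).
  - move=> x; rewrite normrM ler_pM// ger0_norm ?mulr_ge0 ?invr_ge0 ?(ltW r0) ?indicE//.
    by rewrite ler_piMr ?divr_ge0 ?(ltW r0)// lern1 leq_b1.
  - by move=> x xM; rewrite /F2 phi0// mulr0.
split=> //; have : (\int[leb]_x (F1 x + F2 x)%:E = 0)%E.
  rewrite -(cvg_lim _ cvG)//; apply: cvg_lim => //.
  apply: cvg_near_cst; apply: nearW => m; rewrite -(D m).2.
  by apply: eq_integral => x _; rewrite GE.
rewrite (_ : \int[leb]_x (F1 x + F2 x)%:E =
    \int[leb]_x (F1 x)%:E + \int[leb]_x (F2 x)%:E)%E; last first.
  by rewrite -integralD.
have -> : (\int[leb]_x (dotv (calib x) (grad phi x))%:E =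
    (-1)%:E * \int[leb]_x (EFin \o F1) x)%E.
  rewrite -integralZl//; apply: eq_integral => x _.
  by rewrite -EFinM mulN1r /calib dotvZl dotvC mulNr.
have f1 := integrable_fin_num measurableT iF1.
have f2 := integrable_fin_num measurableT iF2.
change ((\int[leb]_x (EFin \o F1) x + \int[leb]_x (EFin \o F2) x = 0)%E ->
  ((-1)%:E * \int[leb]_x (EFin \o F1) x = \int[leb]_x (EFin \o F2) x)%E).
by rewrite -(fineK f1) -(fineK f2) -EFinD -EFinM => -[h12]; congr EFin; lra.
Qed.

End calibration_field.

(** * The total variation of a multiple of the indicator of a ball *)

Section indicator_of_a_ball.
Context {R : realType} {N : nat} (Omega : set 'rV[R]_N) (p : 'rV[R]_N) (r rho0 : R).
Hypotheses (r0 : 0 < r) (r_rho0 : r < rho0).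
Hypothesis ballOmega : forall x, sqd p x <= rho0 ^+ 2 -> Omega x.
Local Notation leb := (lebesgue_rV _).
Let B := cball p r.

Lemma cball_sub x : B x -> Omega x.
Proof.
move=> xB; apply: ballOmega; apply: le_trans xB _.
by rewrite ler_pXn2r// ?nnegrE ?ltW// (lt_trans r0).
Qed.

Lemma integral_indic_cball k (g : 'rV[R]_N -> R) :
  leb.-integrable B (EFin \o g) ->
  (\int[leb]_(x in Omega) (k * \1_B x * g x)%:E =
   k%:E * \int[leb]_(x in B) (g x)%:E)%E.
Proof.
move=> ig; rewrite -integralZl//; last exact: measurable_cball.
rewrite [LHS]integral_mkcond [RHS]integral_mkcond; apply: eq_integral => x _.
rewrite !patchE indicE; have [xB|xB] := boolP (x \in B).
  by rewrite ifT ?mulr1// inE; apply: cball_sub; rewrite inE in xB.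
by case: ifP => // _; rewrite mulr0 mul0r.
Qed.

Lemma continuous_integrable_cball (g : 'rV[R]_N -> R) : continuous g ->
  leb.-integrable B (EFin \o g).
Proof.
move=> cg; pose M := 1 + r ^+ 2 + `|p|.
have subM : B `<=` cube M by move=> x; exact: sqd_cube.
have /compact_bounded[C [_ gC]] : compact (g @` cube M).
  by apply: continuous_compact; [exact: continuous_subspaceT|exact: compact_cube].
apply: measurable_bounded_integrable; [exact: measurable_cball|exact: lebesgue_cball_lty| |].
  by apply: measurable_funTS; exact: continuous_rV_measurable.
exists C; split; first exact: num_real.
by move=> t Ct x xB; apply: gC => //; exists x => //; exact: subM.
Qed.

Lemma integral_indic_cball_cst k :
  (\int[leb]_(x in Omega) (k * \1_B x)%:E = k%:E * leb B)%E.
Proof.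
have := @integral_indic_cball k (cst 1) (continuous_integrable_cball (@cst_continuous _ _ _)).
rewrite (_ : \int[leb]_(x in B) _ = leb B)%E; last first.
  by rewrite -[RHS]mul1e; exact: (integral_cst leb (measurable_cball p r) 1%:E).
by move=> <-; apply: eq_integral => x _; rewrite mulr1.
Qed.

Lemma lebesgue_cball_gt0 : (0 < leb B)%E.
Proof.
(* The cube of half-side t fits in the ball because N t^2 <= r^2; the denominator N + 1 is never
   0. *)
pose t := r / N.+1%:R; have t0 : 0 < t by rewrite divr_gt0.
pose bx := box (p - const_mx t) (p + const_mx t).
have : (0 < leb bx)%E.
  rewrite lebesgue_rV_box => [|i].
    rewrite lte_fin prodr_gt0// => i _; rewrite !mxE; lra.
  by rewrite !mxE; lra.
move=> /lt_le_trans; apply; apply: le_measure; rewrite ?inE.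
- exact: measurable_box.
- exact: measurable_cball.
move=> x bx_x; rewrite /B /cball /= /sqd /dotv.
have xt (i : 'I_N) : (x - p) 0 i * (x - p) 0 i <= t ^+ 2.
  have := bx_x i; rewrite !mxE -expr2 => /andP[h1 h2].
  by rewrite -real_normK ?num_real// ler_pXn2r ?nnegrE ?(ltW t0)// ler_norml; lra.
apply: (@le_trans _ _ (\sum_(i < N) t ^+ 2)); first exact: ler_sum.
rewrite sumr_const card_ord -mulr_natl /t expr_div_n mulrCA ler_piMr ?sqr_ge0//.
rewrite ler_pdivrMr ?exprn_gt0// mul1r -natrX ler_nat.
by rewrite -mulnn (leq_trans (leqnSn N))// leq_pmulr.
Qed.

(** A property failing on all of B, a subset of Omega of positive measure, cannot hold a.e. This
    yields both nontriviality and distinctness of the solutions. *)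
Lemma not_ae_cball (P : 'rV[R]_N -> Prop) : (forall x, B x -> ~ P x) ->
  ~ {ae leb, forall x, Omega x -> P x}.
Proof.
move=> BP [A [mA A0 PA]].
have BA : B `<=` A by move=> x xB; apply: PA => /= /(_ (cball_sub xB)); exact: BP.
have := lebesgue_cball_gt0; rewrite lt0e measure_ge0 andbT => /eqP; apply.
by apply: (subset_measure0 _ mA BA A0); exact: measurable_cball.
Qed.

(** The field is (x - p) / rho times a cutoff that is 1 on B and 0 beyond radius rho: its norm is at
    most 1 since |x - p| <= rho on its support, and its support lies in Omega since rho <= rho0. *)
Lemma cball_test_field rho : r < rho -> rho <= rho0 ->
  exists Phi, [/\ C1c_field Omega Phi, forall x, enorm (Phi x) <= 1 &
    forall x, B x -> divergence Phi x = N%:R / rho].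
Proof.
move=> r_rho rho_rho0.
have rho_gt0 : 0 < rho by exact: lt_trans r_rho.
pose delta := rho ^+ 2 - r ^+ 2.
have delta0 : 0 < delta by rewrite subr_gt0 ltr_pXn2r// nnegrE ltW.
pose h s := rho^-1 * cutoff (r ^+ 2) delta s.
pose dh s := rho^-1 * dcutoff (r ^+ 2) delta s.
have hE (s : R) : is_derive s (1 : R) h (dh s).
  apply: is_derive_eq (is_deriveM (is_derive_cst rho^-1 s (1 : R))
    (is_derive_cutoff (r ^+ 2) delta s)) _.
  by rewrite scaler0 addr0.
have cdh : continuous dh.
  by move=> s; apply: cvgMr; exact: continuous_dcutoff.
have [Ch gradh] := grad_sqd_chain p hE cdh.
exists (fun x => h (sqd p x) *: (x - p)); split.
- split; first exact: C1_field_scale Ch (C1_disp p).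
  exists (cball p rho); split.
  + apply: (@subclosed_compact _ (cball p rho) (cube (1 + rho ^+ 2 + `|p|))).
    * exact: closed_cball.
    * exact: compact_cube.
    by move=> x; exact: sqd_cube.
  + move=> x /= xrho; apply: ballOmega; apply: le_trans xrho _.
    by rewrite ler_pXn2r// ?nnegrE ?ltW// (lt_le_trans rho_gt0).
  + move=> x /negP; rewrite -ltNge => xrho; rewrite /h cutoff_ge ?mulr0 ?scale0r//.
    by rewrite /delta subrKC ltW.
- move=> x; rewrite /enorm -[leRHS]sqrtr1; apply: ler_wsqrtr.
  rewrite dotvZl dotvC dotvZl -/(sqd p x) mulrA -expr2.
  have [xrho|xrho] := leP (sqd p x) (rho ^+ 2); last first.
    rewrite /h cutoff_ge// ?mulr0 ?expr0n ?mul0r//.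
    by rewrite /delta subrKC ltW.
  rewrite /h exprMn exprVn.
  have c1 := cutoff_le1 (r ^+ 2) delta (sqd p x).
  have c0 := cutoff_ge0 (r ^+ 2) delta (sqd p x).
  rewrite -mulrA mulrC ler_pdivrMr ?exprn_gt0// mul1r (le_trans _ xrho)//.
  by rewrite ler_piMl ?sqd_ge0// exprn_ile1.
- move=> x xB; rewrite (divergence_scale x Ch (C1_disp p)) divergence_disp gradh.
  rewrite dotvZl /dh dcutoff_le// !mulr0 mul0r addr0 /h cutoff_le// mulr1.
  by rewrite mulrC.
Qed.

Lemma bv_variation_cball c : 0 < c ->
  bv_variation Omega (fun x => c * \1_B x) = ((c * (N%:R / r))%:E * leb B)%E.
Proof.
move=> c0.
have V0 := measure_ge0 leb B.
apply/eqP; rewrite eq_le; apply/andP; split.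
  apply: ge_ereal_sup => _ /= [Phi [[CPhi _] Phi1] <-].
  have cd := continuous_divergence CPhi.
  rewrite (integral_indic_cball c (continuous_integrable_cball cd)).
  rewrite EFinM -muleA lee_pmul2l ?lte_fin//.
  exact: integral_divergence_cball.
apply/lee_mul01Pr.
  by rewrite mule_ge0// lee_fin mulr_ge0 ?divr_ge0 ?(ltW c0) ?(ltW r0).
move=> t /andP[t0 t1].
(* It suffices to reach each multiple t < 1 of the target: rho <= r / t gives N / rho >= t N / r,
   and t < 1 gives rho > r. *)
pose rho := Num.min (r / t) rho0.
have r_rho : r < rho by rewrite lt_min r_rho0 andbT ltr_pdivlMr// gtr_pMr.
have rho_gt0 : 0 < rho by exact: lt_trans r_rho.
have [|Phi [CPhi Phi1 divPhi]] := cball_test_field r_rho; first by rewrite ge_min lexx orbT.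
apply: (@le_trans _ _ ((c * (N%:R / rho))%:E * leb B)%E).
  rewrite muleA -EFinM lee_wpmul2r// lee_fin mulrCA ler_wpM2l ?(ltW c0)//.
  rewrite mulrCA ler_wpM2l// ler_pdivrMr// [rho^-1 * r]mulrC ler_pdivlMr//.
  by rewrite mulrC -ler_pdivlMr// ge_min lexx.
apply: ereal_sup_ubound => /=; exists Phi => //.
have cd := continuous_divergence CPhi.1.
rewrite (integral_indic_cball c (continuous_integrable_cball cd)) EFinM -muleA.
congr (_ * _)%E; transitivity (\int[leb]_(x in B) (N%:R / rho)%:E)%E.
  by apply: eq_integral => x; rewrite inE => /divPhi ->.
exact: (integral_cst leb (measurable_cball p r) (N%:R / rho)%:E).
Qed.

End indicator_of_a_ball.

(** * The equation for the amplitude c *)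

Section amplitude.
Context {R : realType}.

(** The right-hand side of the problem at a constant value c > 0; [s] stands for the critical
    exponent. *)
Definition reaction (lambda q s c : R) : R :=
  lambda * (c `^ (q - 2) * c) + c `^ (s - 2) * c.

Lemma reaction_powR lambda q s c : 0 < c ->
  reaction lambda q s c = lambda * c `^ (q - 1) + c `^ (s - 1).
Proof.
move=> c0; have E (t : R) : c `^ (t - 2) * c = c `^ (t - 1).
  rewrite -{2}(powRr1 (ltW c0)) -powRD; last by apply/implyP => _; rewrite gt_eqF.
  by congr (_ `^ _); ring.
by rewrite /reaction !E.
Qed.

(** Intermediate value theorem on [a, b]. At [a1] the first term equals k / 2, at [a2] the second
    does, so at their minimum [a] the sum is at most k; at [b] the second term alone is M >= k. *)
Lemma reaction_surj lambda q s k : 0 < lambda -> 1 < q -> 1 < s -> 0 < k ->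
  exists2 c, 0 < c & reaction lambda q s c = k.
Proof.
move=> l0 q1 s1 k0.
have q10 : 0 < q - 1 by rewrite subr_gt0.
have s10 : 0 < s - 1 by rewrite subr_gt0.
pose M := Num.max 1 k.
have M0 : 0 < M by rewrite lt_max ltr01.
have root (t v : R) : 0 < t -> 0 <= v -> (v `^ t^-1) `^ t = v.
  by move=> t0 v0; rewrite -powRrM mulVf ?gt_eqF// powRr1.
pose b := M `^ (s - 1)^-1.
have b0 : 0 < b by rewrite powR_gt0.
pose a1 := (k / (2 * lambda)) `^ (q - 1)^-1.
pose a2 := (k / 2) `^ (s - 1)^-1.
pose a := Num.min a1 a2.
have kl0 : 0 < k / (2 * lambda) by rewrite divr_gt0// mulr_gt0.
have k20 : 0 < k / 2 by rewrite divr_gt0.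
have a0 : 0 < a by rewrite lt_min !powR_gt0.
have ab : a <= b.
  rewrite (@le_trans _ _ a2) ?ge_min ?lexx ?orbT// /a2 /b.
  apply: ge0_ler_powR; rewrite ?nnegrE ?invr_ge0 ?(ltW s10) ?(ltW k20) ?(ltW M0)//.
  by rewrite le_max; apply/orP; right; lra.
have mono (t x y : R) : 0 < t -> 0 < x -> x <= y -> x `^ t <= y `^ t.
  move=> t0 x0 xy; apply: ge0_ler_powR => //; rewrite ?nnegrE ?(ltW t0) ?(ltW x0)//.
  exact: le_trans (ltW x0) xy.
have fa : reaction lambda q s a <= k.
  rewrite reaction_powR//.
  have h1 : lambda * a `^ (q - 1) <= k / 2.
    have -> : k / 2 = lambda * (k / (2 * lambda)) by field; rewrite gt_eqF.
    rewrite ler_pM2l// -[leRHS](root (q - 1))// ?(ltW kl0)//.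
    by apply: mono => //; rewrite ge_min lexx.
  have h2 : a `^ (s - 1) <= k / 2.
    rewrite -[leRHS](root (s - 1))// ?(ltW k20)//.
    by apply: mono => //; rewrite ge_min lexx orbT.
  by rewrite [leRHS](splitr k) lerD.
have fb : k <= reaction lambda q s b.
  rewrite reaction_powR// ler_wpDl ?mulr_ge0 ?powR_ge0 ?(ltW l0)//.
  by rewrite root ?(ltW M0)// le_max lexx orbT.
have [||c] := @IVT R (reaction lambda q s) a b k ab.
- apply: derivable_within_continuous => x; rewrite in_itv/= => /andP[ax _].
  have x0 : 0 < x by exact: lt_le_trans ax.
  have dp t : derivable (fun y : R => y `^ (t - 2) * y) x 1.
    apply: derivableM; last exact: derivable_id.
    by have [] := is_derive1_powR (t - 2) x0.
  apply: derivableD; last exact: dp.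
  by apply: derivableM; [exact: derivable_cst|exact: dp].
- by rewrite ge_min fa le_max fb orbT.
rewrite in_itv/= => /andP[ac _] ck.
by exists c => //; exact: lt_le_trans ac.
Qed.

End amplitude.

(** * The boundary term: integral of 0 against the Hausdorff set function *)

Section integral_of_zero.
Context d (T : measurableType d) (R : realType).
Import HBNNSimple.

(* [integral0] of the library requires a measure, which [hausdorff k] is not
   known to be here. *)
Lemma integral_cst0 (mu : set T -> \bar R) (D : set T) : mu set0 = 0%E ->
  (\int[mu]_(x in D) cst 0 x = 0)%E.
Proof.
move=> mu0; rewrite /integral erestrict0.
have sup0 (g : T -> \bar R) : g = cst 0%E ->
    ereal_sup [set sintegral mu h |
      h in [set h : {nnsfun T >-> R} | forall x, ((h x)%:E <= g x)%E]] = 0%E.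
  move=> ->; have sint0 (h : {nnsfun T >-> R}) : (forall x, h x = 0) ->
      sintegral mu h = 0%E.
    move=> h0; rewrite /sintegral fsbig1// => t _; have [->|t0] := eqVneq t 0.
      by rewrite mul0e.
    rewrite (_ : _ @^-1` _ = set0) ?mu0 ?mule0// -subset0 => x /=.
    by rewrite h0 => /eqP; rewrite eq_sym (negbTE t0).
  rewrite (_ : [set _ | _ in _] = [set 0%E]) ?ereal_sup1//.
  apply/seteqP; split => [_ [h /= h0 <-]|_ ->].
    apply: sint0 => x; apply/eqP; rewrite eq_le fun_ge0 andbT.
    by have := h0 x; rewrite lee_fin.
  by exists nnsfun0 => [x|]; [rewrite /= lee_fin|exact: sint0].
rewrite !sup0 ?sube0//; apply/funext => x.
  by rewrite funenegE /cst oppe0 maxxx.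
by rewrite funeposE /cst maxxx.
Qed.

End integral_of_zero.

Section hausdorff_null.
Context {R : realType} {N : nat}.

(** Covering by empty sets costs 0, and their diameter -oo meets any bound [delta]. This makes the
    boundary integral of 0 vanish and allows the empty set as exceptional set for the trace. *)
Lemma hausdorff0 k : hausdorff k (set0 : set 'rV[R]_N) = 0%E.
Proof.
have pre0 delta : hausdorff_pre k delta (set0 : set 'rV[R]_N) = 0%E.
  apply/eqP; rewrite eq_le; apply/andP; split.
    apply: ereal_inf_lbound; exists (fun=> set0).
      split; first by [].
      by move=> i; apply: ge_ereal_sup => _ [[x y] [/= []]].
    by rewrite eseries0// => i _ _; rewrite /hausdorff_gauge eqxx.
  apply: le_ereal_inf_tmp => _ /= [C _ <-]; apply: nneseries_ge0 => i _ _.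
  rewrite /hausdorff_gauge; case: ifPn => [//|/set0P[x Cx]].
  rewrite mule_ge0// lee_fin exprn_ge0// divr_ge0// fine_ge0//.
  apply: ereal_sup_ubound; exists (x, x) => //=.
  by rewrite subrr /enorm /dotv big1 ?sqrtr0// => j _; rewrite mxE mul0r.
rewrite /hausdorff (_ : [set _ | _ in _] = [set 0%E]) ?ereal_sup1//.
apply/seteqP; split => [_ [d _ <-]|_ ->]; first exact: pre0.
by exists 1; [rewrite /= ltr01|exact: pre0].
Qed.

Lemma integral0_hausdorff k (D : set 'rV[R]_N) :
  (\int[hausdorff k]_(x in D) (`|(cst 0 : 'rV[R]_N -> R) x|)%:E = 0)%E.
Proof.
rewrite (_ : (fun x : 'rV[R]_N => _) = cst 0%E); last first.
  by apply/funext => x; rewrite /= normr0.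
by rewrite integral_cst0//; exact: hausdorff0.
Qed.

End hausdorff_null.

(** * Multiples of indicators of balls as solutions *)

Section ball_solutions.
Context {R : realType} {N : nat} (Omega : set 'rV[R]_N) (p : 'rV[R]_N) (r rho0 : R).
Hypotheses (N2 : (2 <= N)%N) (oOmega : open Omega) (r0 : 0 < r) (r_rho0 : r < rho0).
Hypothesis ballOmega : forall x, sqd p x <= rho0 ^+ 2 -> Omega x.
Local Notation leb := (lebesgue_rV _).
Let B := cball p r.

(** [calib_weak_div] integrates over the whole space; test functions and their gradients vanish
    outside a compact subset of Omega, so nothing changes on restricting to Omega. *)
Lemma calib_is_weak_div :
  is_weak_div Omega (calib p r) (fun x => - (N%:R / r * \1_B x)).
Proof.
move=> phi [Cphi [K [cK KOmega phi0]]].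
have Cphi1 : Ck 1 phi by exact: Cphi.
have [M [_ KM]] := compact_bounded cK.
have phiM x : ~ cube (M + 1) x -> phi x = 0.
  move=> xM; apply: phi0 => xK; apply: xM; apply/cubeP => i.
  rewrite (le_trans _ (KM (M + 1) _ x xK)) ?ltrDl//.
  rewrite [leRHS]/Num.norm /= mx_normrE.
  exact: (le_bigmax _ (fun ij => `|x ij.1 ij.2|) (0, i)).
have cKc : open (~` K).
  by apply: closed_openC; apply: compact_closed => //; exact: norm_hausdorff.
have grad0 x : ~ K x -> grad phi x = 0.
  move=> xK; apply/rowP => i; rewrite !mxE /partial -(derive_cst 0 x (basis_vec i)).
  apply: near_eq_derive; move: cKc; rewrite openE => /(_ _ xK).
  by apply: filterS => z; exact: phi0.
have [i2 E] := calib_weak_div p r0 Cphi1 phiM.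
have onOmega (g : 'rV[R]_N -> R) : (forall x, ~ K x -> g x = 0) ->
    (\int[leb]_(x in Omega) (g x)%:E = \int[leb]_x (g x)%:E)%E.
  move=> g0; rewrite [LHS]integral_mkcond; apply: eq_integral => x _.
  rewrite patchE; case: ifPn => // /negP xO; rewrite g0// => xK.
  by apply: xO; rewrite inE; exact: KOmega.
rewrite onOmega; last first.
  by move=> x /grad0 ->; rewrite /dotv big1// => i _; rewrite [X in _ * X]mxE mulr0.
rewrite E onOmega; last by move=> x /phi0 ->; rewrite mulr0.
rewrite (_ : \int[leb]_x (- (N%:R / r * \1_B x) * phi x)%:E =
    (-1)%:E * \int[leb]_x (N%:R / r * \1_B x * phi x)%:E)%E; last first.
  rewrite -integralZl//; apply: eq_integral => x _.
  by rewrite -EFinM mulN1r mulNr.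
by rewrite EFinN mulN1e oppeK.
Qed.

(** Omega is open and contains the closed ball of radius rho0, so a boundary point is farther than
    rho0 from p: balls of radius less than rho0 - r around it miss B, and the integrals are 0. *)
Lemma is_trace_cball c : is_trace Omega (fun x => c * \1_B x) (cst 0).
Proof.
split; first exact: measurable_cst.
exists set0; split; [exact: measurable0|exact: hausdorff0|].
move=> x /= []; move=> [clx nintx].
have xO : ~ Omega x by move=> xO; apply: nintx; rewrite (interior_id _).1.
have farx : rho0 < enorm (x - p).
  rewrite ltNge; apply/negP => h; apply: xO; apply: ballOmega.
  by rewrite -enorm_sqd ler_pXn2r// ?nnegrE ?enorm_ge0// ltW// (lt_trans r0).
apply: cvg_near_cst; near=> d.
have d0 : d < rho0 - r by near: d; apply: nbhs_right_lt; rewrite subr_gt0.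
rewrite integral0_eq ?mule0// => y [_ xy].
have yB : ~ B y.
  move=> yB; have yr : enorm (y - p) <= r.
    by rewrite -(@ler_pXn2r _ 2)// ?nnegrE ?enorm_ge0 ?(ltW r0)// enorm_sqd.
  have : enorm (x - p) <= enorm (y - x) + enorm (y - p).
    by rewrite -(subrKA y x) -(opprB y) (le_trans (enormD _ _))// enormN.
  move: xy; rewrite /eball /=; lra.
by rewrite indicE memNset// mulr0 subr0 normr0.
Unshelve. all: by end_near. Qed.

(** Both sides of the energy identity are c (N / r) |B|, the boundary term being 0. The equation is
    [fc] on B and 0 = 0 off B. *)
Lemma cball_is_solution lambda q c : 0 < c ->
  reaction lambda q (@crit_exp R N) c = N%:R / r ->
  is_solution Omega lambda q (fun x => c * \1_B x).
Proof.
move=> c0 fc; have mO := open_rV_measurable oOmega.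
have V1 : leb B \is a fin_num.
  by rewrite ge0_fin_numE; [exact: lebesgue_cball_lty|exact: measure_ge0].
have mI (k : R) : measurable_fun Omega (fun x : 'rV[R]_N => k * \1_B x).
  apply: measurable_funM; first exact: measurable_cst.
  exact: measurable_indic (measurable_cball p r).
have bv := bv_variation_cball r0 r_rho0 ballOmega c0.
split.
  split; last by rewrite bv -(fineK V1) -EFinM ltry.
  apply/integrableP; split; first exact/measurable_EFinP.
  rewrite (_ : \int[leb]_(x in Omega) _ = \int[leb]_(x in Omega) (c * \1_B x)%:E)%E.
    by rewrite (integral_indic_cball_cst r0 r_rho0 ballOmega) -(fineK V1) -EFinM ltry.
  apply: eq_integral => x _; rewrite /= ger0_norm// mulr_ge0 ?(ltW c0)// indicE//.
exists (calib p r), (fun x => - (N%:R / r * \1_B x)), (cst 0); split.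
- split; first by apply: measurable_funTS; exact: measurable_calib.
  by apply: aeW => x _; exact: enorm_calib.
- split; last exact: calib_is_weak_div.
  split; first exact: measurable_funN.
  rewrite (_ : \int[leb]_(x in Omega) _ =
      \int[leb]_(x in Omega) ((N%:R / r) `^ N%:R * \1_B x)%:E)%E.
    by rewrite (integral_indic_cball_cst r0 r_rho0 ballOmega) -(fineK V1) -EFinM ltry.
  apply: eq_integral => x _; congr EFin; rewrite normrN indicE; case: (x \in B).
    by rewrite !mulr1 ger0_norm// divr_ge0// ltW.
  by rewrite !mulr0 normr0 powR0// pnatr_eq0; case: (N) N2.
- exact: is_trace_cball.
- rewrite integral0_hausdorff adde0 bv.
  rewrite (_ : \int[leb]_(x in Omega) _ =
      \int[leb]_(x in Omega) (- (c * (N%:R / r)) * \1_B x)%:E)%E.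
    by rewrite (integral_indic_cball_cst r0 r_rho0 ballOmega) EFinN mulNe oppeK.
  apply: eq_integral => x _; congr EFin; rewrite indicE.
  by case: (x \in B); rewrite /=; ring.
- apply: aeW => x _; rewrite opprK indicE; case: (x \in B).
    by rewrite !mulr1 (ger0_norm (ltW c0)) -fc.
  by rewrite !mulr0 addr0.
Qed.

End ball_solutions.

(* A function in BV is a class modulo equality a.e. in Omega: "nontrivial" and
   "distinct" are understood modulo this equality. *)
Theorem theorem1p2 (R : realType) (N : nat) (hN : (2 <= N)%N)
    (Omega : set 'rV[R]_N) (hOmega : smooth_bounded_domain Omega)
    (q : R) (hq1 : 1 < q) (hq2 : q < @crit_exp R N) (n : nat) :
  exists2 lambda_n : R, 0 < lambda_n &
    forall lambda : R, lambda_n <= lambda ->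
      exists u : 'I_n -> 'rV[R]_N -> R,
        (forall i, is_solution Omega lambda q (u i) /\
                   ~ ae_eq_in Omega (u i) (fun=> 0)) /\
        (forall i j, i != j -> ~ ae_eq_in Omega (u i) (u j)).
Proof.
(* The threshold 1 serves for every n: once lambda > 0, each admissible radius gives a solution. *)
exists 1 => // lambda lambda1.
have l0 : 0 < lambda by exact: lt_le_trans lambda1.
have s1 : 1 < @crit_exp R N by exact: lt_trans hq2.
case: hOmega => -[p Op] oOmega _ _ _.
have [e e0 eO] := nbhs_rV_cube (open_nbhs_nbhs (conj oOmega Op)).
pose rho0 := e / 2.
have rho0_gt0 : 0 < rho0 by rewrite divr_gt0.
have ballO x : sqd p x <= rho0 ^+ 2 -> Omega x.
  move=> xr; apply: eO => i; apply: (@le_lt_trans _ _ rho0).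
    rewrite -(@ler_pXn2r _ 2)// ?nnegrE ?(ltW rho0_gt0)//.
    apply: le_trans xr; rewrite real_normK ?num_real// /sqd /dotv (bigD1 i)//=.
    rewrite !mxE -[X in X <= _]sqrrN opprB -expr2 lerDl.
    by apply: sumr_ge0 => j _; rewrite -expr2 sqr_ge0.
  by rewrite /rho0 ltr_pdivrMr// ltr_pMr// ltr1n.
(* Denominators from 2 on keep these distinct radii strictly below [rho0]. *)
pose rad (i : 'I_n) := rho0 / i.+2%:R.
have rad0 i : 0 < rad i by rewrite divr_gt0.
have rad_lt i : rad i < rho0 by rewrite ltr_pdivrMr// ltr_pMr// ltr1n.
have N0 : 0 < N%:R :> R by rewrite ltr0n; case: (N) hN.
have amp i : {c | 0 < c & reaction lambda q (@crit_exp R N) c = N%:R / rad i}.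
  by apply: cid2; apply: reaction_surj => //; rewrite divr_gt0.
pose c i := s2val (amp i).
have c0 i : 0 < c i := s2valP (amp i).
have cE i : reaction lambda q (@crit_exp R N) (c i) = N%:R / rad i := s2valP' (amp i).
exists (fun i x => c i * \1_(cball p (rad i)) x); split=> [i|i j ij].
  split.
    exact: (cball_is_solution hN oOmega (rad0 i) (rad_lt i) ballO (c0 i) (cE i)).
  apply: (not_ae_cball (rad0 i) (rad_lt i) ballO) => x xB.
  by rewrite indicE mem_set// mulr1 => /eqP; rewrite gt_eqF.
(* Equal amplitudes would have equal reactions N / [rad i] and N / [rad j]. *)
have cij : c i <> c j.
  move=> cc; have := cE i; rewrite cc cE => /(mulfI (lt0r_neq0 N0))/invr_inj.
  move=> /(mulfI (lt0r_neq0 rho0_gt0))/invr_inj/eqP.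
  by rewrite eqr_nat !eqSS => /eqP/val_inj/eqP; rewrite eq_sym (negbTE ij).
(* On the smaller of the two concentric balls both functions are constant, with the different values
   [c i] and [c j]; by symmetry it is the i-th. *)
wlog le_ij : i j ij cij / rad i <= rad j.
  move=> H; have [/H|/ltW] := leP (rad i) (rad j); first exact.
  move=> ji; have := H j i; rewrite eq_sym => /(_ ij (fun h => cij (esym h)) ji) h.
  by move=> ae; apply: h; apply: filterS ae => x + Ox => /(_ Ox).
apply: (not_ae_cball (rad0 i) (rad_lt i) ballO) => x xB.
rewrite !indicE !mem_set//; first by rewrite !mulr1.
by apply: le_trans xB _; rewrite ler_pXn2r// nnegrE ltW.
Qed.
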